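(* Let $X$ be a proper CAT(0) space and let $G$ be a group acting geometrically on $X$. If $\partial_c X \neq \emptyset$ and $G$ is not virtually cyclic, then for every $\alpha \in \partial_c X$ the orbit $G\alpha$ is dense in $\partial_c X$ (with respect to the direct limit topology on the contracting boundary).
   Context: A geometric action is a properly discontinuous, cocompact action by isometries. A geodesic is (the image of) an isometric embedding of $\mathbb{R}$ or of an interval of $\mathbb{R}$; $\pi_a$ denotes nearest-point projection to the geodesic $a$. A geodesic $a$ in a CAT(0) space $X$ is $A$-contracting if for all $x,y\in X$, $d(x,y)<d(x,\pi_a(x))$ implies $d(\pi_a(x),\pi_a(y))<A$; it is contracting if it is $A$-contracting for some $A$. The visual boundary $\partial X$ is the set of geodesic rays up to bounded distance, with the cone topology; fixing a base point $x$, each point of $\partial X$ is represented by a unique ray from $x$. For $D\ge 0$, $\partial_c^D X_x\subseteq\partial X$ is the set of points whose representing ray from $x$ is $D$-contracting, with the subspace topology. The contracting boundary $\partial_c X=\partial_c X_x$ is the union $\bigcup_{D\ge0}\partial_c^D X_x$ with the direct limit topology: a set is open (closed) if and only if its intersection with each $\partial_c^D X_x$ is open (closed) in $\partial_c^D X_x$. The resulting space does not depend on $x$ up to homeomorphism (via the natural identification), and $G$ acts on it. *)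

(* Defs.v *)
From HB Require Import structures.
From mathcomp Require Import all_boot all_order all_algebra.
From mathcomp Require Import all_classical all_reals all_analysis.

Set Implicit Arguments.
Unset Strict Implicit.
Unset Printing Implicit Defensive.

Import Order.TTheory GRing.Theory Num.Theory.

Local Open Scope classical_set_scope.
Local Open Scope ring_scope.
Local Open Scope quotient_scope.

Section CAT0_spaces.
Context {R : realType}.

Definition euclid_dist (u v : R * R) : R :=
  Num.sqrt ((u.1 - v.1) ^+ 2 + (u.2 - v.2) ^+ 2).

Definition euclid_segment (u v : R * R) : set (R * R) :=
  [set ((1 - t) * u.1 + t * v.1, (1 - t) * u.2 + t * v.2) | t in `[0, 1]].

Definition geodesic_segment (X : metricType R) (x y : X) (c : R -> X) : Prop :=
  [/\ c 0 = x, c (mdist x y) = y &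
      forall s t, 0 <= s <= mdist x y -> 0 <= t <= mdist x y ->
        mdist (c s) (c t) = `|s - t|].

(* Side [i] of a geodesic triangle joins [p i] to [p (i + 1)], the index being
   computed modulo 3; [q] is the triple of vertices of a comparison triangle in
   the Euclidean plane. *)
Definition CAT0 (X : metricType R) : Prop :=
  (forall x y : X, exists c, geodesic_segment x y c) /\
  forall (p : 'I_3 -> X) (c : 'I_3 -> R -> X) (q : 'I_3 -> R * R),
    (forall i, geodesic_segment (p i) (p (i + 1)) (c i)) ->
    (forall i, euclid_dist (q i) (q (i + 1)) = mdist (p i) (p (i + 1))) ->
    forall (i j : 'I_3) (x y : X) (x' y' : R * R),
      (c i @` `[0, mdist (p i) (p (i + 1))]) x ->
      (c j @` `[0, mdist (p j) (p (j + 1))]) y ->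
      euclid_segment (q i) (q (i + 1)) x' ->
      euclid_dist (q i) x' = mdist (p i) x ->
      euclid_segment (q j) (q (j + 1)) y' ->
      euclid_dist (q j) y' = mdist (p j) y ->
      mdist x y <= euclid_dist x' y'.

Definition proper_space (X : metricType R) : Prop :=
  forall (x : X) (r : R), compact [set y | mdist x y <= r].

(* The nearest-point projection to [a] is treated as a relation; when [a] is a
   geodesic ray in a CAT(0) space it is the graph of a function. *)
Definition is_projection (X : metricType R) (a : set X) (x p : X) : Prop :=
  a p /\ forall q, a q -> mdist x p <= mdist x q.

Definition contracting (X : metricType R) (A : R) (a : set X) : Prop :=
  forall x y px py, is_projection a x px -> is_projection a y py ->
    mdist x y < mdist x px -> mdist px py < A.

End CAT0_spaces.

Section group_actions.
Context {R : realType}.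

Record isometric_action (G : groupType) (X : metricType R) := IsometricAction {
  act :> G -> X -> X ;
  act1 : forall x, act 1%g x = x ;
  actM : forall g h x, act (g * h)%g x = act g (act h x) ;
  act_mdist : forall g x y, mdist (act g x) (act g y) = mdist x y
}.

Definition properly_discontinuous (G : groupType) (X : metricType R)
    (a : isometric_action G X) : Prop :=
  forall K : set X, compact K ->
    finite_set [set g : G | (a g @` K) `&` K !=set0].

Definition cocompact (G : groupType) (X : metricType R)
    (a : isometric_action G X) : Prop :=
  exists2 K : set X, compact K & \bigcup_(g : G) (a g @` K) = setT.

Definition geometric_action (G : groupType) (X : metricType R)
    (a : isometric_action G X) : Prop :=
  properly_discontinuous a /\ cocompact a.

Definition cyclic_subgroup (G : groupType) (g : G) : set G :=
  [set h | exists n : nat, h = (g ^+ n)%g \/ h = (g ^- n)%g].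

Definition left_coset (G : groupType) (H : set G) (t : G) : set G :=
  [set (t * h)%g | h in H].

Definition virtually_cyclic (G : groupType) : Prop :=
  exists g : G, finite_set (range (left_coset (cyclic_subgroup g))).

End group_actions.

Section visual_boundary.
Context {R : realType} {X : metricType R}.

(* Only the values of [ray_fun] on nonnegative reals are meaningful; [asymptotic]
   below ignores the others, so they play no role in the boundary. *)
Record geodesic_ray := GeodesicRay {
  ray_fun :> R -> X ;
  ray_isometric : forall s t, 0 <= s -> 0 <= t ->
    mdist (ray_fun s) (ray_fun t) = `|s - t|
}.

HB.instance Definition _ := gen_eqMixin geodesic_ray.
HB.instance Definition _ := gen_choiceMixin geodesic_ray.

Definition ray_image (c : geodesic_ray) : set X := c @` `[0, +oo[.

Definition asymptotic (c c' : geodesic_ray) : bool :=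
  `[< exists K : R, forall t, 0 <= t -> mdist (c t) (c' t) <= K >].

Lemma asymptotic_refl : reflexive asymptotic.
Proof. by move=> c; apply/asboolP; exists 0 => t _; rewrite mdistxx. Qed.

Lemma asymptotic_sym : symmetric asymptotic.
Proof.
by move=> c c'; apply/asboolP/asboolP => -[K cK]; exists K => t t0;
  rewrite metric_sym cK.
Qed.

Lemma asymptotic_trans : transitive asymptotic.
Proof.
move=> c2 c1 c3 /asboolP[K cK] /asboolP[L cL]; apply/asboolP.
exists (K + L) => t t0; apply: le_trans (metric_triangle _ (c2 t) _) _.
by rewrite lerD ?cK ?cL.
Qed.

Canonical asymptotic_equiv :=
  EquivRel asymptotic asymptotic_refl asymptotic_sym asymptotic_trans.

Definition boundary := {eq_quot asymptotic_equiv}.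
HB.instance Definition _ := Choice.on boundary.
HB.instance Definition _ := Quotient.on boundary.

Definition represents (x : X) (c : geodesic_ray) (xi : boundary) : Prop :=
  c 0 = x /\ \pi_boundary c = xi.

(* The base point enters only through the cone topology. *)
Definition visual_boundary (x : X) : Type := boundary.
HB.instance Definition _ (x : X) := Choice.on (visual_boundary x).

Definition cone_nbhd (x : X) (xi : visual_boundary x) (r e : R) :
    set (visual_boundary x) :=
  [set eta | exists c c' : geodesic_ray,
     [/\ represents x c xi, represents x c' eta &
         forall t, 0 <= t <= r -> mdist (c t) (c' t) < e]].

Definition cone_open (x : X) : set_system (visual_boundary x) :=
  [set U | forall xi, U xi -> exists r e : R,
     [/\ 0 <= r, 0 < e & cone_nbhd xi r e `<=` U]].

Lemma cone_openT (x : X) : cone_open [set: visual_boundary x].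
Proof. by move=> xi _; exists 0, 1; split. Qed.

Lemma cone_openI (x : X) : setI_closed (@cone_open x).
Proof.
move=> U V oU oV xi [/oU[r [e [r0 e0 rU]]] /oV[s [f [s0 f0 sV]]]].
exists (Num.max r s), (Num.min e f); split.
- by rewrite le_max r0.
- by rewrite lt_min e0.
- move=> eta [c [c' [cxi ceta cc']]]; split.
  + apply: rU; exists c, c'; split=> // t /andP[t0 tr].
    have := cc' t; rewrite t0 le_max tr lt_min => /(_ isT) /andP[//].
  + apply: sV; exists c, c'; split=> // t /andP[t0 ts].
    have := cc' t; rewrite t0 le_max ts orbT lt_min => /(_ isT) /andP[//].
Qed.

Lemma cone_open_bigU (x : X) (I : Type) (f : I -> set (visual_boundary x)) :
  (forall i, cone_open (f i)) -> cone_open (\bigcup_i f i).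
Proof.
move=> of_ xi [i _ fxi]; have [r [e [r0 e0 rf]]] := of_ i _ fxi.
by exists r, e; split=> // eta /rf; exists i.
Qed.

HB.instance Definition _ (x : X) := isOpenTopological.Build (visual_boundary x)
  (@cone_openT x) (@cone_openI x) (@cone_open_bigU x).

End visual_boundary.

Arguments geodesic_ray {R} X.
Arguments boundary {R} X.

Section contracting_boundary.
Context {R : realType} {X : metricType R}.

Definition contracting_stratum (x : X) (D : R) : set (visual_boundary x) :=
  [set xi | exists2 c : geodesic_ray X,
     represents x c xi & contracting D (ray_image c)].

(* A record rather than a subset of the visual boundary, so that no subspace
   topology competes with the direct limit topology. *)
Record contracting_boundary (x : X) := ContractingPoint {
  cb_point :> visual_boundary x ;
  cb_contracting : exists2 D : R, 0 <= D & contracting_stratum D cb_point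
}.

HB.instance Definition _ (x : X) := gen_eqMixin (contracting_boundary x).
HB.instance Definition _ (x : X) := gen_choiceMixin (contracting_boundary x).

(* [cb_point] is injective and every stratum lies in its range, so [U] meets the
   stratum [D] in the set [cb_point @` U `&` contracting_stratum D]; the library
   topology on [subspace A] restricted to subsets of [A] is the usual one. *)
Definition direct_limit_open (x : X) : set_system (contracting_boundary x) :=
  [set U | forall D : R, 0 <= D ->
     open ((@cb_point x @` U) `&` @contracting_stratum x D
           : set (subspace (@contracting_stratum x D)))].

Lemma cb_point_inj (x : X) : injective (@cb_point x).
Proof.
by move=> [u pu] [v pv] /= uv; move: pu pv; rewrite uv => pu pv;
  congr ContractingPoint; exact: Prop_irrelevance.
Qed.

Lemma direct_limit_openT (x : X) : direct_limit_open [set: contracting_boundary x].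
Proof.
move=> D D0; rewrite (_ : _ `&` _ = @contracting_stratum x D).
  exact: open_subspaceT.
by apply/seteqP; split=> [xi []//|xi xiD]; split=> //;
  exists (ContractingPoint (ex_intro2 _ _ D D0 xiD)).
Qed.

Lemma direct_limit_openI (x : X) : setI_closed (@direct_limit_open x).
Proof.
move=> U V oU oV D D0.
rewrite (_ : cb_point (x:=x) @` _ = (cb_point (x:=x) @` U) `&` (cb_point (x:=x) @` V)).
  by rewrite setIIl; apply: openI; [exact: oU|exact: oV].
apply/seteqP; split=> [_ [u [Uu Vu] <-]|xi [[u Uu uE] [v Vv vE]]].
  by split; exists u.
by exists u => //; split=> //; rewrite (@cb_point_inj x u v) // uE vE.
Qed.

Lemma direct_limit_open_bigU (x : X) (I : Type)
    (f : I -> set (contracting_boundary x)) :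
  (forall i, direct_limit_open (f i)) -> direct_limit_open (\bigcup_i f i).
Proof.
move=> of_ D D0; rewrite image_bigcup setI_bigcupl.
by apply: bigcup_open => i _; exact: of_.
Qed.

HB.instance Definition _ (x : X) :=
  isOpenTopological.Build (contracting_boundary x)
  (@direct_limit_openT x) (@direct_limit_openI x) (@direct_limit_open_bigU x).

End contracting_boundary.

Section boundary_action.
Context {R : realType} {G : groupType} {X : metricType R}.
Variable a : isometric_action G X.

Lemma act_ray_isometric (g : G) (c : geodesic_ray X) (s t : R) :
  0 <= s -> 0 <= t -> mdist (a g (c s)) (a g (c t)) = `|s - t|.
Proof. by move=> s0 t0; rewrite act_mdist ray_isometric. Qed.

Definition act_ray (g : G) (c : geodesic_ray X) : geodesic_ray X :=
  GeodesicRay (@act_ray_isometric g c).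

Definition act_boundary (g : G) (xi : boundary X) : boundary X :=
  \pi_(boundary X) (act_ray g (repr xi)).

Lemma act_boundary_pi (g : G) (c : geodesic_ray X) :
  act_boundary g (\pi_(boundary X) c) = \pi_(boundary X) (act_ray g c).
Proof.
apply/eqmodP/asboolP; have /eqmodP/asboolP[K cK] := reprK (\pi_(boundary X) c).
by exists K => t t0 /=; rewrite act_mdist; exact: cK.
Qed.

(* The translate [g xi] of a contracting point is again contracting, so this is
   the full orbit of [xi] under the action on the boundary. *)
Definition contracting_orbit (x : X) (xi : contracting_boundary x) :
    set (contracting_boundary x) :=
  [set eta | exists g : G, cb_point eta = act_boundary g (cb_point xi)].

End boundary_action.

(* Main.v *)
Require Import Defs.
From HB Require Import structures.
From mathcomp Require Import all_boot all_order all_algebra.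
From mathcomp Require Import all_classical all_reals all_analysis.
From mathcomp Require Import ring lra.

(* If [G] fixed a contracting point, represented by a ray [c], every [g]
   would eventually shift [c] by some [s g], up to a bounded error, and [s] would
   be a quasimorphism.  Conjugation by elements moving a base point far along
   [c] shows that its bounded fibres are finite, so [G] would be virtually
   cyclic.  Hence some [k] moves [alpha].

   Let [b] and [c] be the rays from [x] to [beta] and [alpha], and let
   [g] move [x] close to [b n].  The ray from [g x] to [g alpha] and the one from
   [g k x] to [g k alpha] cannot both backtrack along [b] for long, since after
   applying [g^-1] they would fellow travel each other.  Follow [b] up to time
   [n] and then the one that does not backtrack: the ray [sg] from [x] with the
   same endpoint stays close to this concatenation, so that [sg] is contracting
   with a constant independent of [n], while by convexity [sg t] and [b t] are
   [O(t / n)] apart for [t <= n].  The uniform constant puts these points in a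
   single stratum, so they converge to [beta] in the direct limit topology. *)

Set Implicit Arguments.
Unset Strict Implicit.
Unset Printing Implicit Defensive.

Import Order.TTheory GRing.Theory Num.Theory.
Import numFieldNormedType.Exports.

Local Open Scope classical_set_scope.
Local Open Scope ring_scope.

(** * Convexity of the metric *)

Section Convexity.
Context {R : realType} {X : metricType R}.
Implicit Types (f g : R -> X) (x y z : X).

(** Parametrization proportional to arc length on the unit interval, so that convexity compares two
    geodesics at equal parameters. *)
Definition affine_geodesic f : Prop := forall s t : R, 0 <= s <= 1 -> 0 <= t <= 1 ->
  mdist (f s) (f t) = `|s - t| * mdist (f 0) (f 1).

Lemma affine_geodesic_rev f :
  affine_geodesic f -> affine_geodesic (fun t => f (1 - t)).
Proof.
move=> gf s t s01 t01; rewrite subr0 subrr [mdist (f 1) _]metric_sym gf; try lra.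
by congr (_ * _); rewrite distrC; congr `|_|; ring.
Qed.

Lemma affine_geodesic_segment f : affine_geodesic f ->
  geodesic_segment (f 0) (f 1) (fun t => f (t / mdist (f 0) (f 1))).
Proof.
move=> gf; set A := mdist _ _.
have A0 : 0 <= A by exact: mdist_ge0.
case: (eqVneq A 0) => [AE|An0].
  have f01 : f 0 = f 1 by exact: mdist_positivity.
  rewrite AE; split; rewrite ?invr0 ?mulr0// -/A AE => s t /andP[s0 s1] /andP[t0 t1].
  have -> : s = 0 by lra.
  have -> : t = 0 by lra.
  by rewrite !(mulr0, invr0) subrr normr0 mdistxx.
have Agt0 : 0 < A by lra.
split; rewrite ?mul0r ?divff// => s t /andP[s0 s1] /andP[t0 t1].
rewrite gf ?divr_ge0 ?ler_pdivrMr ?mul1r //.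
by rewrite -mulrBl normrM (gtr0_norm (_ : 0 < A^-1)) ?invr_gt0// mulfVK.
Qed.

Lemma segment_affine_geodesic x y c : geodesic_segment x y c ->
  affine_geodesic (fun t => c (t * mdist x y)).
Proof.
move=> [c0 c1 gc] s t s01 t01; rewrite mul0r mul1r c0 c1.
have d0 := mdist_ge0 x y.
rewrite gc; first by rewrite -mulrBl normrM (ger0_norm d0).
- by rewrite mulr_ge0 ?ler_piMl//; lra.
- by rewrite mulr_ge0 ?ler_piMl//; lra.
Qed.

(** The law of cosines gives the abscissa [x] of [v]. One vertex sits at the origin, so that
    comparison points on the two sides issuing from it are multiples of [u] and [v]. *)
Lemma comparison_triangle (A B E : R) : 0 <= A -> 0 <= B -> 0 <= E ->
  A <= B + E -> B <= A + E -> E <= A + B ->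
  exists u v : R * R, [/\ euclid_dist u 0 = A, euclid_dist 0 v = B &
    euclid_dist v u = E].
Proof.
move=> A0 B0 E0 h1 h2 h3.
case: (eqVneq A 0) => [AE|An0].
  exists (0, 0), (B, 0); rewrite /euclid_dist /= AE !(subr0, sub0r).
  rewrite sqrrN expr0n !addr0 sqrtr0 sqrtr_sqr ger0_norm//; split=> //; lra.
have Agt0 : 0 < A by lra.
pose x := (A ^+ 2 + B ^+ 2 - E ^+ 2) / (2 * A).
have xB : x ^+ 2 <= B ^+ 2.
  have xl : - B <= x by rewrite /x ler_pdivlMr; [nra|lra].
  have xr : x <= B by rewrite /x ler_pdivrMr; [nra|lra].
  nra.
have Y2 : Num.sqrt (B ^+ 2 - x ^+ 2) ^+ 2 = B ^+ 2 - x ^+ 2 by rewrite sqr_sqrtr; lra.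
exists (A, 0), (x, Num.sqrt (B ^+ 2 - x ^+ 2)); rewrite /euclid_dist /= !(subr0, sub0r).
rewrite !sqrrN Y2 expr0n addr0 sqrtr_sqr ger0_norm//; split=> //.
  by rewrite addrC subrK sqrtr_sqr ger0_norm.
rewrite (_ : _ + _ = E ^+ 2) ?sqrtr_sqr ?ger0_norm//.
by rewrite /x; field.
Qed.

Hypothesis catX : CAT0 X.

Lemma affine_geodesic_exists x y :
  exists f, [/\ affine_geodesic f, f 0 = x & f 1 = y].
Proof.
have [c gc] := catX.1 x y; exists (fun t => c (t * mdist x y)).
by case: (gc) => c0 c1 _; rewrite mul0r mul1r; split=> //; exact: segment_affine_geodesic.
Qed.

(** In a comparison triangle with the common origin placed at 0, the points [f l] and [g l]
    correspond to [l * u] and [l * v], whose distance is exactly [l] times that of [u] and [v]. *)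
Lemma affine_geodesic_thales f g l : affine_geodesic f -> affine_geodesic g ->
  f 0 = g 0 -> 0 <= l <= 1 -> mdist (f l) (g l) <= l * mdist (f 1) (g 1).
Proof.
move=> gf gg fg0 /andP[l0 l1].
have [h [gh h0 h1]] := affine_geodesic_exists (g 1) (f 1).
set A := mdist (f 0) (f 1); set B := mdist (g 0) (g 1); set E := mdist (f 1) (g 1).
have [|||u [v [uA vB uvE]]] := @comparison_triangle A B E (mdist_ge0 _ _)
  (mdist_ge0 _ _) (mdist_ge0 _ _).
- by rewrite /A /B /E fg0 [mdist (f 1) _]metric_sym metric_triangle.
- by rewrite /A /B /E fg0 metric_triangle.
- by rewrite /A /B /E -fg0 [mdist (f 0) (f 1)]metric_sym metric_triangle.
pose p (i : 'I_3) := nth (f 1) [:: f 1; f 0; g 1] i.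
pose c (i : 'I_3) := nth (f) [:: (fun t => f (1 - t / A));
  (fun t => g (t / B)); (fun t => h (t / mdist (g 1) (f 1)))] i.
pose q (i : 'I_3) := nth u [:: u; 0; v] i.
have EA : mdist (f 1) (f 0) = A by rewrite metric_sym.
have EB : mdist (f 0) (g 1) = B by rewrite fg0.
have sc : forall i, geodesic_segment (p i) (p (i + 1)) (c i).
  case=> [[|[|[|//]]] i3]; rewrite /p /c /=.
  - have := affine_geodesic_segment (affine_geodesic_rev gf).
    by rewrite subr0 subrr EA.
  - have := affine_geodesic_segment gg.
    by rewrite fg0.
  - have := affine_geodesic_segment gh.
    by rewrite h0 h1.
have qd : forall i, euclid_dist (q i) (q (i + 1)) = mdist (p i) (p (i + 1)).
  case=> [[|[|[|//]]] i3]; rewrite /p /q /= ?EA ?EB//.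
  by rewrite uvE metric_sym.
have := catX.2 p c q sc qd (@Ordinal 3 0 isT) (@Ordinal 3 1 isT) (f l) (g l)
  (l * u.1, l * u.2) (l * v.1, l * v.2).
rewrite /p /c /q /= EA EB.
have eA (k : R) (w : R * R) : euclid_dist (k * w.1, k * w.2) 0 = `|k| * euclid_dist w 0.
  rewrite /euclid_dist /= !subr0 !exprMn -mulrDr sqrtrM ?sqr_ge0//.
  by rewrite sqrtr_sqr.
have eB (k : R) (w : R * R) : euclid_dist 0 (k * w.1, k * w.2) = `|k| * euclid_dist 0 w.
  rewrite /euclid_dist /= !sub0r !sqrrN !exprMn -mulrDr sqrtrM ?sqr_ge0//.
  by rewrite sqrtr_sqr.
have eC (k : R) (w w' : R * R) :
    euclid_dist (k * w.1, k * w.2) (k * w'.1, k * w'.2) = `|k| * euclid_dist w w'.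
  rewrite /euclid_dist /= -!mulrBr !exprMn -mulrDr sqrtrM ?sqr_ge0//.
  by rewrite sqrtr_sqr.
rewrite eC (ger0_norm l0) eB vB (ger0_norm l0).
have -> : euclid_dist u v = E.
  by rewrite -uvE /euclid_dist; congr Num.sqrt; ring.
apply.
- exists ((1 - l) * A); rewrite /=.
    by rewrite in_itv /= mulr_ge0 ?ler_piMl ?mdist_ge0//; lra.
  (* If [A] is 0, dividing by it yields 0 and the side is evaluated at [f 1], which then coincides
     with [f l]. *)
  case: (eqVneq A 0) => [A0|An0]; last by rewrite mulfK// subKr.
  apply: mdist_positivity; rewrite gf; try (rewrite A0 invr0 mulr0; lra); try lra.
  by rewrite -/A A0 mulr0.
- exists (l * B); rewrite /=.
    by rewrite in_itv /= mulr_ge0 ?ler_piMl ?mdist_ge0//; lra.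
  case: (eqVneq B 0) => [B0|Bn0]; last by rewrite mulfK.
  apply: mdist_positivity; rewrite gg; try (rewrite B0 invr0 mulr0; lra); try lra.
  by rewrite -/B B0 mulr0.
- exists (1 - l); first by rewrite /= in_itv /=; lra.
  by rewrite /=; congr (_, _); ring.
- rewrite gf; try lra.
  rewrite -/A -uA -[X in _ = X * _](ger0_norm (_ : 0 <= `|1 - l|)) //.
  rewrite /euclid_dist /= !subr0.
  rewrite (_ : (u.1 - l * u.1) ^+ 2 + (u.2 - l * u.2) ^+ 2 =
    (1 - l) ^+ 2 * (u.1 ^+ 2 + u.2 ^+ 2)); last by ring.
  by rewrite sqrtrM ?sqr_ge0// sqrtr_sqr normr_id.
- exists l; first by rewrite /= in_itv /=; lra.
  by rewrite /=; congr (_, _); ring.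
- rewrite fg0 gg; try lra.
  by rewrite sub0r normrN (ger0_norm l0).
Qed.

(** The diagonal [h] from [f 0] to [g 1] cuts the quadrilateral into two triangles, each handled by
    [affine_geodesic_thales] at its own vertex. *)
Lemma affine_geodesic_convex f g l : affine_geodesic f -> affine_geodesic g ->
  0 <= l <= 1 ->
  mdist (f l) (g l) <= (1 - l) * mdist (f 0) (g 0) + l * mdist (f 1) (g 1).
Proof.
move=> gf gg l01.
have [h [gh h0 h1]] := affine_geodesic_exists (f 0) (g 1).
apply: le_trans (metric_triangle _ (h l) _) _; rewrite addrC; apply: lerD.
  have := affine_geodesic_thales (affine_geodesic_rev gh) (affine_geodesic_rev gg)
    _ (_ : 0 <= 1 - l <= 1).
  by rewrite !subr0 !subrr h0 h1 !subKr; apply=> //; lra.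
by rewrite -h1; apply: affine_geodesic_thales.
Qed.

End Convexity.

(** * Unit-speed arcs and convexity of distances along them *)

Section Arcs.
Context {R : realType} {X : metricType R}.
Implicit Types (s : R -> X) (c : geodesic_ray X) (x y z : X).

(* Restated so that the order and the norm of [R] come from the structures
   inferred here: [lra] does not identify them with those of the library lemmas. *)
Lemma triangle x y z : mdist x z <= mdist x y + mdist y z :> R.
Proof. exact: metric_triangle. Qed.

Lemma mdistC x y : mdist x y = mdist y x :> R.
Proof. exact: metric_sym. Qed.

Lemma mdist_pos x y : 0 <= mdist x y :> R.
Proof. exact: mdist_ge0. Qed.

Lemma mdist_ray c (p q : R) : 0 <= p -> 0 <= q -> mdist (c p) (c q) = `|p - q| :> R.
Proof. exact: ray_isometric. Qed.

Definition geodesic_arc (L : R) s : Prop := forall p q : R, 0 <= p <= L -> 0 <= q <= L ->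
  mdist (s p) (s q) = `|p - q| :> R.

Lemma arc_rev L s : geodesic_arc L s -> geodesic_arc L (fun p => s (L - p)).
Proof.
move=> gs p q p0 q0; rewrite gs; try lra.
by rewrite distrC; congr `|_|; ring.
Qed.

Lemma arcS L L' s : L' <= L -> geodesic_arc L s -> geodesic_arc L' s.
Proof. by move=> LL gs p q p0 q0; apply: gs; lra. Qed.

Lemma arc_point y : geodesic_arc 0 (fun=> y).
Proof.
move=> p q p0 q0; have -> : p = 0 by lra.
have -> : q = 0 by lra.
by rewrite subrr normr0 mdistxx.
Qed.

Lemma arc_ray L c : geodesic_arc L c.
Proof. by move=> p q p0 q0; apply: mdist_ray; lra. Qed.

Lemma arc_affine_geodesic L s (a b : R) : geodesic_arc L s -> 0 <= a <= L -> 0 <= b <= L ->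
  affine_geodesic (fun l => s ((1 - l) * a + l * b)).
Proof.
move=> gs a0 b0.
have H l : 0 <= l <= 1 -> 0 <= (1 - l) * a + l * b <= L.
  by move=> l01; apply/andP; split; nra.
move=> p q p0 q0; rewrite !gs; try (apply: H; lra); rewrite -normrM.
by rewrite distrC; congr `|_|; ring.
Qed.

Hypothesis catX : CAT0 X.

Lemma arc_exists y z : exists s, [/\ geodesic_arc (mdist y z) s, s 0 = y & s (mdist y z) = z].
Proof. by have [s [? ? ?]] := catX.1 y z; exists s. Qed.

Lemma arc_convex (L L' : R) s s' (a a' b b' l : R) : geodesic_arc L s -> geodesic_arc L' s' ->
  0 <= a <= L -> 0 <= a' <= L -> 0 <= b <= L' -> 0 <= b' <= L' -> 0 <= l <= 1 ->
  mdist (s ((1 - l) * a + l * a')) (s' ((1 - l) * b + l * b')) <=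
    (1 - l) * mdist (s a) (s' b) + l * mdist (s a') (s' b').
Proof.
move=> gs gs' a0 a0' b0 b0' l01.
have := affine_geodesic_convex catX (arc_affine_geodesic gs a0 a0')
  (arc_affine_geodesic gs' b0 b0') l01.
by rewrite !subr0 subrr !mul1r !mul0r !addr0 !add0r.
Qed.

(** The distance to [y] is convex along [s], the point [y] being regarded as an arc of length 0, so
    between [a] and [b] it stays below the larger end value. *)
Lemma mdist_arc_le (L : R) s y (a b e : R) : geodesic_arc L s -> 0 <= a <= L -> 0 <= b <= L ->
  (a <= e <= b \/ b <= e <= a) -> mdist y (s a) <= mdist y (s b) ->
  mdist y (s e) <= mdist y (s b).
Proof.
move=> gs a0 b0 he hab.
case: (eqVneq a b) => [E|nE].
  by rewrite (_ : e = b) //; lra.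
pose l := (e - a) / (b - a).
have ba0 : b - a != 0 by rewrite subr_eq0 eq_sym.
have lE : l * (b - a) = e - a by rewrite mulfVK.
have l01 : 0 <= l <= 1.
  case: he => he.
    by rewrite divr_ge0 ?ler_pdivrMr /=; lra.
  have -> : l = (a - e) / (a - b) by rewrite /l; field; rewrite subr_eq0 nE ba0.
  by rewrite divr_ge0 ?ler_pdivrMr /=; lra.
have := @arc_convex _ _ _ _ 0 0 a b l (arc_point y) gs.
rewrite (_ : (1 - l) * a + l * b = e); last first.
  by rewrite (_ : e = a + l * (b - a)) ?lE; lra.
move=> /(_ _ _ a0 b0 l01) H; apply: le_trans (H _ _) _; try lra.
nra.
Qed.

End Arcs.

(** * Projections to a contracting ray *)

Section Contraction.
Context {R : realType} {X : metricType R}.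
Implicit Types (s : R -> X) (c : geodesic_ray X) (x y z : X).

(** A projection is recorded by its parameter on [c], so that distances between projections are
    differences of reals. *)
Definition ray_projection c y (u : R) : Prop :=
  0 <= u /\ forall p : R, 0 <= p -> mdist y (c u) <= mdist y (c p).

Definition ray_contracting (D : R) c : Prop := forall y z (u v : R),
  ray_projection c y u -> ray_projection c z v -> mdist y z < mdist y (c u) ->
  `|u - v| < D.

Lemma ray_imageP c y : ray_image c y <-> exists2 u : R, 0 <= u & y = c u.
Proof.
split=> [[u]|[u u0 ->]]; last by exists u => //=; rewrite in_itv /= u0.
by rewrite /= in_itv /= andbT => u0 <-; exists u.
Qed.

Lemma contracting_ray_image D c : contracting D (ray_image c) <-> ray_contracting D c.
Proof.
split=> cD.
  move=> y z u v [u0 yu] [v0 zv] yz; rewrite -(mdist_ray c u0 v0).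
  apply: cD yz; split; first by apply/ray_imageP; exists u.
  - by move=> _ /ray_imageP[p p0 ->]; exact: yu.
  - by apply/ray_imageP; exists v.
  - by move=> _ /ray_imageP[p p0 ->]; exact: zv.
move=> y z _ _ [/ray_imageP[u u0 ->] yu] [/ray_imageP[v v0 ->] zv] yz.
rewrite mdist_ray//; apply: cD yz; split=> // p p0.
  by apply: yu; apply/ray_imageP; exists p.
by apply: zv; apply/ray_imageP; exists p.
Qed.

Lemma ray_contractingW D D' c : D <= D' -> ray_contracting D c -> ray_contracting D' c.
Proof. by move=> DD cD y z u v yu zv /(cD _ _ _ _ yu zv) h; apply: lt_le_trans DD. Qed.

Lemma ray_projection_exists c y : exists u, ray_projection c y u.
Proof.
(* The absolute value extends the ray to the whole line, where [f] is 1-Lipschitz. *)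
pose f (t : R) := mdist y (c `|t|).
have fl (s t : R) : `|f s - f t| <= `|s - t|.
  have st : mdist (c `|s|) (c `|t|) <= `|s - t|.
    by rewrite mdist_ray// ler_dist_dist.
  rewrite /f ler_norml.
  have := triangle y (c `|s|) (c `|t|).
  have := triangle y (c `|t|) (c `|s|).
  rewrite [mdist (c `|t|) _]mdistC; lra.
have fc : continuous f.
  move=> t; apply/cvgrPdist_lt => e e0; near=> s.
  apply: le_lt_trans (fl _ _) _; near: s.
  by apply/nbhs_ballP; exists e.
(* Beyond this parameter every point of [c] is at least as far from [y] as [c 0] is, so a minimum
   over a compact interval suffices. *)
have L0 : 0 <= 2 * mdist y (c 0) by rewrite mulr_ge0// mdist_pos.
have [u] := EVT_min L0 (continuous_subspaceT fc).
rewrite in_itv /= => /andP[u0 uL] um; exists u; split=> // p p0.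
have [pL|pL] := leP p (2 * mdist y (c 0)).
  by have := um p; rewrite in_itv /= p0 pL /f !ger0_norm// => ->.
have := um 0; rewrite in_itv /= lexx L0 /f normr0 ger0_norm// => /(_ isT).
have := triangle (c 0) y (c p).
rewrite mdist_ray// sub0r normrN ger0_norm// [mdist (c 0) _]mdistC; lra.
Unshelve. all: by end_near. Qed.

(** The strict inequality lets contraction apply to a step of length exactly [2 * D] starting at
    [y]. *)
Definition far c (D : R) y : Prop := forall p : R, 0 <= p -> 2 * D < mdist y (c p).

Lemma ray_projection_unique c (D : R) y (u v : R) : 0 < D -> ray_contracting D c ->
  ray_projection c y u -> ray_projection c y v -> `|u - v| < D.
Proof.
move=> D0 cD yu yv; have [y0|y0] := leP (mdist y (c u)) 0; last first.
  by apply: (cD _ _ _ _ yu yv); rewrite mdistxx.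
case: (yu) (yv) => u0 uP [v0 vP].
have := triangle (c u) y (c v); rewrite mdist_ray// mdistC.
by have := vP _ u0; lra.
Qed.

(** Each step of length [2 * D] starts at a far point and moves the projection by less than [D].
    Only starting points of steps must be far, so [e] itself may be near [c]; the last, shorter step
    accounts for [n.+1]. *)
Lemma far_steps c (D L : R) s n (a e u v : R) : 0 < D -> ray_contracting D c ->
  geodesic_arc L s -> 0 <= a -> a <= e -> e <= L ->
  e - a <= n%:R * (2 * D) -> (forall p, a <= p < e -> far c D (s p)) ->
  ray_projection c (s a) u -> ray_projection c (s e) v -> `|u - v| <= n.+1%:R * D.
Proof.
move=> D0 cD gs a0; elim: n e v => [|n IH] e v ae eL ean fars au ev.
  move: ev; rewrite (_ : e = a); last by lra.
  by move=> ev; rewrite mul1r; apply/ltW/(ray_projection_unique D0 cD au ev).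
have [le|lt] := leP (e - a) (n%:R * (2 * D)).
  apply: le_trans (IH _ _ ae eL le fars au ev) _.
  by rewrite ler_pM2r// ler_nat.
have n0 : 0 <= n%:R * (2 * D) by rewrite mulr_ge0//; lra.
have [ae'|ae'] := leP a (e - 2 * D); last first.
  have := cD _ _ _ _ au ev; rewrite gs; try lra.
  move=> H; apply/ltW; apply: lt_le_trans (H _) _.
    rewrite distrC ger0_norm; last by lra.
    by apply: lt_trans (fars a _ u _); try lra; case: au.
  by rewrite ler_peMl ?ler1n//; lra.
have [q eq] := ray_projection_exists c (s (e - 2 * D)).
have fare : far c D (s (e - 2 * D)) by apply: fars; lra.
have IHq : `|u - q| <= n.+1%:R * D.
  have : e - 2 * D - a <= n%:R * (2 * D) by move: ean; rewrite -natr1 mulrDl mul1r; lra.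
  move=> ean'; apply: (IH (e - 2 * D) q) => //; first lra.
  by move=> p ?; apply: fars; lra.
have qv : `|q - v| < D.
  apply: (cD _ _ _ _ eq ev); rewrite gs; try lra.
  rewrite (_ : e - 2 * D - e = - (2 * D)); last by ring.
  by rewrite normrN ger0_norm; [apply: fare; case: eq|lra].
rewrite -[n.+2%:R]natr1 mulrDl mul1r.
by rewrite (_ : u - v = (u - q) + (q - v)); [apply: le_trans (ler_normD _ _) _; lra|ring].
Qed.

(* Balls of radius up to the distance to [c] have projections of diameter
   less than [D], which disposes of the two ends of [s]; what remains has length
   at most [|u - v| + 4 * D] and its shadow moves at speed at most [1 / 2]. *)
Lemma far_shadow c (D L : R) s (u v : R) : 0 < D -> ray_contracting D c ->
  geodesic_arc L s -> 0 <= L ->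
  (forall p, 0 <= p < L -> far c D (s p)) ->
  ray_projection c (s 0) u -> ray_projection c (s L) v -> `|u - v| <= 12 * D.
Proof.
move=> D0 cD gs L0 fars su sv.
have sL : mdist (s 0) (s L) = L.
  by rewrite gs; [rewrite sub0r normrN ger0_norm|lra|lra].
have [Lu|Lu] := ltP L (mdist (s 0) (c u)).
  by apply: (@le_trans _ _ D); [apply/ltW/(cD _ _ _ _ su sv); rewrite sL|lra].
have [Lv|Lv] := ltP L (mdist (s L) (c v)).
  apply: (@le_trans _ _ D); last lra.
  by rewrite distrC; apply/ltW/(cD _ _ _ _ sv su); rewrite mdistC sL.
have [e [q [e0 eL eq qv]]] : exists e q, [/\ 0 <= e <= L,
    e <= L - mdist (s L) (c v) + 2 * D, ray_projection c (s e) q & `|q - v| < D].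
  have [vD|vD] := leP (mdist (s L) (c v)) (2 * D).
    exists L, v; rewrite subrr normr0; split=> //; lra.
  exists (L - mdist (s L) (c v) + 2 * D).
  have [q eq] := ray_projection_exists c (s (L - mdist (s L) (c v) + 2 * D)).
  exists q; split=> //; first lra.
  rewrite distrC; apply: (cD _ _ _ _ sv eq); rewrite gs; try lra.
  by rewrite ger0_norm; lra.
have qvE := qv; rewrite ltr_norml in qvE.
have [eu|eu] := ltP e (mdist (s 0) (c u)).
  have : `|u - q| < D.
    apply: (cD _ _ _ _ su eq); rewrite gs; try lra.
    by rewrite sub0r normrN ger0_norm; lra.
  by rewrite ltr_norml ler_norml; lra.
(* For [L = 0] no point is known to be far, but [u] and [q] then project the same point. *)
have [Lz|Lz] := eqVneq L 0.
  have E0 : e = 0 by lra.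
  rewrite E0 in eq.
  have := ray_projection_unique D0 cD su eq.
  by rewrite ltr_norml ler_norml; lra.
have uD : 2 * D < mdist (s 0) (c u) by apply: fars; [lra|case: su].
pose a := mdist (s 0) (c u) - 2 * D.
have [p ap] := ray_projection_exists c (s a).
have up : `|u - p| < D.
  apply: (cD _ _ _ _ su ap); rewrite gs; try (rewrite /a; lra).
  by rewrite sub0r normrN ger0_norm /a; lra.
have [ru rv] : 0 <= u /\ 0 <= v by split; [case: su|case: sv].
have LP : L <= mdist (s 0) (c u) + `|u - v| + mdist (s L) (c v).
  rewrite -(mdist_ray c)// [mdist (s L) _]mdistC.
  have := triangle (s 0) (c u) (s L); have := triangle (c u) (c v) (s L).
  by rewrite sL; lra.
have P0 : 0 <= `|u - v| by exact: normr_ge0.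
pose N := `|u - v| / (2 * D) + 2.
have N0 : 0 <= N by rewrite addr_ge0// divr_ge0//; lra.
have /andP[N1 N2] := truncn_itv N0.
have ND : N * (2 * D) = `|u - v| + 4 * D by rewrite /N mulrDl mulfVK; lra.
have : `|p - q| <= (Num.trunc N).+2%:R * D.
  apply: (@far_steps c D L s _ a e) => //; rewrite ?/a; try lra.
    apply: (@le_trans _ _ (N * (2 * D))); first by rewrite ND; lra.
    by rewrite ler_pM2r; lra.
  by move=> r ?; apply: fars; lra.
have : (Num.trunc N).+2%:R * D <= (N + 2) * D.
  by rewrite ler_pM2r// -addn2 natrD lerD2r.
have -> : (N + 2) * D = `|u - v| / 2 + 4 * D by rewrite mulrDl; lra.
move=> h1 h2.
(* The middle term is at most [|u - v| / 2 + 4 * D] and the outer ones less than [D] each; absorbing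
   the half gives [12 * D]. *)
have : `|u - v| <= `|u - p| + `|p - q| + `|q - v|.
  rewrite (_ : u - v = (u - p) + (p - q) + (q - v)); last by ring.
  by apply: le_trans (ler_normD _ _) _; rewrite lerD2r ler_normD.
lra.
Qed.

End Contraction.

(** * Arcs passing near a contracting ray, and contraction detected by bottlenecks *)

Section Contraction_CAT0.
Context {R : realType} {X : metricType R}.
Implicit Types (s : R -> X) (c sg : geodesic_ray X) (x y z : X).

Lemma not_far c (D : R) y (u : R) :
  ray_projection c y u -> ~ far c D y -> mdist y (c u) <= 2 * D.
Proof.
move=> [u0 yu] nf; rewrite leNgt; apply/negP => lt; apply: nf => p p0.
exact: lt_le_trans (yu p p0).
Qed.

(** Before the infimum of the near parameters [s] is far from [c], so [far_shadow] costs [12 * D]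
    there, and one more step costs [D]. *)
Lemma first_near_point c (D L : R) s (u : R) : 0 < D -> ray_contracting D c ->
  geodesic_arc L s -> ray_projection c (s 0) u ->
  (exists2 p : R, 0 <= p <= L & ~ far c D (s p)) ->
  exists p q : R, [/\ 0 <= p <= L, ray_projection c (s p) q,
    mdist (s p) (c q) <= 2 * D & `|u - q| <= 13 * D].
Proof.
move=> D0 cD gs su [p0 p0L np0].
have [f0|nf0] := pselect (far c D (s 0)); last first.
  exists 0, u; rewrite subrr normr0; split=> //; try lra.
  exact: not_far.
pose S := [set p | 0 <= p <= L /\ ~ far c D (s p)].
have hS : has_inf S.
  split; first by exists p0.
  by exists 0 => p [/andP[]].
(* The infimum need not be a near parameter; a near [p] within [D] of it is enough, since
   [p - 2 * D] lies before the infimum. *)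
have [p [pL np] pS] := inf_adherent D0 hS.
have [q pq] := ray_projection_exists c (s p).
exists p, q; split=> //; first exact: not_far.
have Sp : inf S <= p by apply: (ge_inf hS.2).
have fS (r : R) : 0 <= r -> r < inf S -> far c D (s r).
  move=> r0 rS; apply: contrapT => nr.
  have : inf S <= r by apply: (ge_inf hS.2); split=> //; lra.
  lra.
have [p2|p2] := ltP p (2 * D).
  apply: (@le_trans _ _ D); last lra.
  apply/ltW/(cD _ _ _ _ su pq); rewrite gs; try lra.
  rewrite sub0r normrN ger0_norm; last lra.
  by apply: lt_trans p2 _; apply: f0; case: su.
have [q' pq'] := ray_projection_exists c (s (p - 2 * D)).
have h1 : `|u - q'| <= 12 * D.
  apply: (@far_shadow _ _ c D (p - 2 * D) s) => //; try lra.
    by apply: arcS gs; lra.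
  by move=> r rp; apply: fS; lra.
have h2 : `|q' - q| < D.
  apply: (cD _ _ _ _ pq' pq); rewrite gs; try lra.
  rewrite (_ : p - 2 * D - p = - (2 * D)); last by ring.
  rewrite normrN ger0_norm; last lra.
  by apply: fS; [lra|lra|case: pq'].
rewrite (_ : u - q = (u - q') + (q' - q)); last by ring.
by apply: le_trans (ler_normD _ _) _; lra.
Qed.

Hypothesis catX : CAT0 X.

(** The near points first met from either end of [s] have projections [q1] and [q2] with [w] between
    them; convexity keeps the subarc joining them within [2 * D] of [c] at proportional
    parameters. *)
Lemma arc_near_ray c (D L : R) s (u v w : R) : 0 < D -> ray_contracting D c ->
  geodesic_arc L s -> 0 <= L -> ray_projection c (s 0) u -> ray_projection c (s L) v ->
  u + 13 * D <= w -> w <= v - 13 * D ->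
  exists2 p : R, 0 <= p <= L & mdist (s p) (c w) <= 2 * D.
Proof.
move=> D0 cD gs L0 su sv uw wv.
have nf : exists2 p : R, 0 <= p <= L & ~ far c D (s p).
  apply: contrapT => nf.
  have : `|u - v| <= 12 * D.
    apply: (far_shadow D0 cD gs L0 _ su sv) => p pL.
    by apply: contrapT => np; apply: nf; exists p => //; lra.
  by rewrite ler_norml; lra.
have [p1 [q1 [p1L pq1 d1 uq1]]] := first_near_point D0 cD gs su nf.
have := @first_near_point c D L (fun p => s (L - p)) v D0 cD (arc_rev gs).
rewrite subr0 => /(_ sv)[|p2 [q2 [p2L pq2 d2 vq2]]].
  by case: nf => p pL np; exists (L - p); [lra|rewrite subKr].
have q10 := pq1.1; have q20 := pq2.1.
rewrite ler_norml in uq1; rewrite ler_norml in vq2.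
have [q12|q12] := eqVneq q1 q2.
  by exists p1 => //; rewrite (_ : w = q1) //; lra.
have lt12 : q1 < q2 by lra.
pose l := (w - q1) / (q2 - q1).
have l01 : 0 <= l <= 1 by rewrite divr_ge0 ?ler_pdivrMr /=; lra.
have lw : l * (q2 - q1) = w - q1 by rewrite mulfVK// subr_eq0 eq_sym.
exists ((1 - l) * p1 + l * (L - p2)); first by apply/andP; split; nra.
have -> : w = (1 - l) * q1 + l * q2 by lra.
apply: le_trans (@arc_convex _ _ catX L q2 s c p1 (L - p2) q1 q2 l gs _ _ _ _ _ _) _; try lra.
  exact: arc_ray.
nra.
Qed.

Lemma mdist_arc_split (L : R) s (p : R) : geodesic_arc L s -> 0 <= p <= L ->
  mdist (s 0) (s L) = mdist (s 0) (s p) + mdist (s p) (s L) :> R.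
Proof.
move=> gs pL; rewrite !gs; try lra.
by rewrite !sub0r !normrN (distrC p) !ger0_norm; lra.
Qed.

(** Arcs whose ends project to opposite sides of a window about [t] must pass near [c t]. Unlike
    contraction itself, this is local along the ray and passes to fellow travellers. *)
Definition bottleneck c (K E t : R) : Prop := forall y z (u v : R) L s,
  ray_projection c y u -> ray_projection c z v -> u <= t - K -> t + K <= v ->
  0 <= L -> geodesic_arc L s -> s 0 = y -> s L = z ->
  exists2 p : R, 0 <= p <= L & mdist (s p) (c t) <= E.

(** A bottleneck at [t] between [u] and [v] puts some [s p] within [E] of [c t]. As [z] is closer to
    [y] than [c u] is, it lies within [E] of [s p], hence within [2 * E] of [c t] and of [c v],
    which is absurd if [t] and [v] differ by [4 * E]. *)
Lemma bottlenecks_contracting c (K E W : R) : 0 <= K -> 0 <= E -> 0 <= W ->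
  (forall t0 : R, 0 <= t0 -> exists2 t : R, t0 <= t <= t0 + W & 0 <= t /\ bottleneck c K E t) ->
  ray_contracting (2 * K + W + 4 * E) c.
Proof.
move=> K0 E0 W0 good y z u v yu zv yz; rewrite ltNge; apply/negP => uv.
have [u0 v0] : 0 <= u /\ 0 <= v by split; [case: yu|case: zv].
have main (t p L : R) s : 0 <= t -> geodesic_arc L s -> 0 <= p <= L -> s 0 = y -> s L = z ->
    mdist (s p) (c t) <= E -> 4 * E <= `|v - t| -> False.
  move=> t0 gs pL s0 sL pt vt.
  have := mdist_arc_split gs pL; rewrite s0 sL => ysplit.
  have h1 := yu.2 t t0; have h2 := zv.2 t t0.
  have h3 := triangle y (s p) (c t).
  have h4 := triangle z (s p) (c t).
  have h5 := triangle (c v) (s p) (c t).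
  have h6 := triangle (c v) z (s p).
  rewrite mdist_ray// in h5; rewrite [mdist z (s p)]mdistC in h4 h6.
  rewrite [mdist (c v) z]mdistC in h6.
  lra.
have [s [gs s0 sL]] := arc_exists catX y z.
have [uv'|uv'] := leP u v.
  rewrite distrC ger0_norm in uv; last lra.
  have [t tu [t0 tb]] := good (u + K) (addr_ge0 u0 K0).
  have [p pL pt] := tb y z u v _ s yu zv ltac:(lra) ltac:(lra) (mdist_pos y z) gs s0 sL.
  by apply: (main t p _ s t0 gs pL s0 sL pt); rewrite ger0_norm; lra.
rewrite ger0_norm in uv; last lra.
(* Now [v] is the left end, so the required gap [4 * E] is left on its side. *)
have [t tu [t0 tb]] := good (v + K + 4 * E) ltac:(lra).
have [p pL pt] := tb z y v u _ _ zv yu ltac:(lra) ltac:(lra) (mdist_pos y z)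
  (arc_rev gs) (etrans (congr1 s (subr0 _)) sL) (etrans (congr1 s (subrr _)) s0).
apply: (main t (mdist y z - p) _ s t0 gs _ s0 sL pt); first lra.
by rewrite distrC ger0_norm; lra.
Qed.

(* Distances to [y] do not decrease along [sg] beyond a projection of [y], so a
   geodesic from [y] to [sg m] cannot come close to a point further away. *)
Lemma not_past_projection sg y (u m m' B : R) p L s : ray_projection sg y u ->
  0 <= m -> 0 <= m' -> (u <= m <= m' \/ m' <= m <= u) ->
  geodesic_arc L s -> s 0 = y -> s L = sg m -> 0 <= p <= L ->
  mdist (s p) (sg m') <= B -> 2 * B < `|m - m'| -> False.
Proof.
move=> yu m0 m'0 mm gs s0 sL pL pm Bm.
have u0 := yu.1.
have := mdist_arc_split gs pL; rewrite s0 sL => ysplit.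
have h1 := triangle y (s p) (sg m').
have h2 := triangle (sg m) (s p) (sg m').
rewrite mdist_ray// [mdist _ (s p)]mdistC in h2.
have : mdist y (sg m) <= mdist y (sg m').
  apply: (@mdist_arc_le _ _ catX (u + m + m') sg y u m' m) => //; try lra.
  - exact: arc_ray.
  - exact: yu.2.
lra.
Qed.

(** If the projection of [y] to [c] lay beyond the left end of the window by more than
    [2 * H + 26 * D], an arc from [y] to [sg (t - K)] would pass near a later point of [sg], against
    [not_past_projection]; likewise for [z] on the right. The remaining [13 * D] in [K] is the
    margin of [arc_near_ray]. *)
Lemma bottleneck_transfer sg c (D H r t : R) : 0 < D -> 0 <= H ->
  ray_contracting D c -> let K := 2 * H + 39 * D in
  0 <= t - K -> 0 <= t - K + r ->
  (forall p : R, t - K <= p <= t + K -> mdist (sg p) (c (p + r)) <= H) ->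
  bottleneck sg K (2 * D + H) t.
Proof.
move=> D0 H0 cD K tK trK fel y z u v L s yu zv ut tv L0 gs s0 sL.
have KE : K = 2 * H + 39 * D by [].
clearbody K.
have close m e : t - K <= m <= t + K -> ray_projection c (sg m) e -> `|e - (m + r)| <= 2 * H.
  move=> mK [e0 me]; rewrite -(mdist_ray c)//; last lra.
  have := triangle (c e) (sg m) (c (m + r)); rewrite [mdist (c e) (sg m)]mdistC.
  by have := fel m mK; have := me (m + r) ltac:(lra); lra.
have near m w q : 0 <= w -> t - K <= w - r <= t + K -> mdist (q : X) (c w) <= 2 * D ->
    m = w - r -> mdist q (sg m) <= 2 * D + H.
  move=> w0 wr qw ->; have := triangle q (c w) (sg (w - r)).
  by have := fel _ wr; rewrite subrK [mdist (c w) (sg _)]mdistC; lra.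
have [a ya] := ray_projection_exists c y.
have [b zb] := ray_projection_exists c z.
have u0 := yu.1.
have left : a <= t - K + r + 2 * H + 26 * D.
  rewrite leNgt; apply/negP => lta.
  have [e me] := ray_projection_exists c (sg (t - K)).
  have := close _ _ _ me; rewrite ler_norml => /(_ ltac:(lra)) eK.
  have [s' [gs' s'0 s'L]] := arc_exists catX y (sg (t - K)).
  set L' := mdist _ _ in gs' s'L.
  have [||p pL pw] := @arc_near_ray c D L' (fun p => s' (L' - p)) e a
    (t - K + r + 2 * H + 13 * D) D0 cD (arc_rev gs') (mdist_pos _ _) _ _
    ltac:(lra) ltac:(lra).
  - by rewrite subr0 s'L.
  - by rewrite subrr s'0.
  apply: (@not_past_projection sg y u (t - K) (t - K + 2 * H + 13 * D) (2 * D + H)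
    (L' - p) L' s') => //; try lra.
  - by apply: near pw _; lra.
  - by rewrite distrC ger0_norm; lra.
have right : t + K + r - 2 * H - 26 * D <= b.
  rewrite leNgt; apply/negP => ltb.
  have [e me] := ray_projection_exists c (sg (t + K)).
  have := close _ _ _ me; rewrite ler_norml => /(_ ltac:(lra)) eK.
  have [s' [gs' s'0 s'L]] := arc_exists catX z (sg (t + K)).
  set L' := mdist _ _ in gs' s'L.
  have [||p pL pw] := @arc_near_ray c D L' s' b e (t + K + r - 2 * H - 13 * D)
    D0 cD gs' (mdist_pos _ _) _ _ ltac:(lra) ltac:(lra).
  - by rewrite s'0.
  - by rewrite s'L.
  apply: (@not_past_projection sg z v (t + K) (t + K - 2 * H - 13 * D) (2 * D + H)
    p L' s') => //; try lra.
  - by apply: near pw _; lra.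
  - by rewrite ger0_norm; lra.
rewrite -s0 in ya; rewrite -sL in zb.
have [p pL pw] := @arc_near_ray c D L s a b (t + r) D0 cD gs L0 ya zb
  ltac:(lra) ltac:(lra).
by exists p => //; apply: near pw _; lra.
Qed.

End Contraction_CAT0.

(** * Asymptotic rays *)

Section Rays.
Context {R : realType} {X : metricType R}.
Implicit Types (s : R -> X) (c : geodesic_ray X) (x y z : X).

Lemma compact_bounded_mdist (K : set X) x : compact K ->
  exists r : R, forall y, K y -> mdist x y <= r.
Proof.
move=> cK; apply: contrapT => nb.
have /choice[u uP] n : exists y, K y /\ n%:R < mdist x y.
  apply: contrapT => nu; apply: nb; exists n%:R => y Ky.
  by rewrite leNgt; apply/negP => lt; apply: nu; exists y.
have [|p [_ pu]] := cK (u @ \oo) _; first by exists 0%N => // n _; exact: (uP n).1.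
have := truncn_itv (addr_ge0 (mdist_pos x p) (@ler01 R)).
set N := (Num.trunc _).+1 => /andP[_ NP].
have [||q [[n Nn <-] pq]] := pu (u @` [set n | (N <= n)%N]) (ball p 1).
- by exists N => // n Nn; exists n.
- exact: nbhsx_ballx.
move: pq; rewrite ballEmdist /= => pq.
have := triangle x p (u n); have := (uP n).2.
have : N%:R <= n%:R :> R by rewrite ler_nat.
lra.
Qed.

Lemma asymptotic_bound c c' : asymptotic c c' ->
  exists2 K : R, 0 <= K & forall t : R, 0 <= t -> mdist (c t) (c' t) <= K.
Proof.
move=> /asboolP[K cK]; exists K => //; apply: le_trans (cK 0 _) => //.
exact: mdist_ge0.
Qed.

Hypothesis propX : proper_space X.

(** One cluster point inherits all bounds on tails at once, so explicit Cauchy estimates pass to it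
    with their constants. *)
Lemma proper_cluster (u : nat -> X) x (r : R) (N : nat) :
  (forall n, (N <= n)%N -> mdist x (u n) <= r) ->
  exists p, forall n (b : R),
    (forall m, (n <= m)%N -> mdist (u n) (u m) <= b) -> mdist (u n) p <= b.
Proof.
move=> ur.
have cB : compact [set y | mdist x y <= r] by exact: propX.
have [|p [_ pu]] := cB (u @ \oo) _; first by exists N.
exists p => n b nb; apply/ler_addgt0Pl => e e0.
have [||q [[m nm <-] pq]] := pu (u @` [set m | (n <= m)%N]) (ball p e).
- by exists n => // m nm; exists m.
- exact: nbhsx_ballx.
move: pq; rewrite ballEmdist /= mdistC => pq.
by have := triangle (u n) (u m) p; have := nb m nm; lra.
Qed.

Hypothesis catX : CAT0 X.

Lemma arc_thales (L L' : R) s s' (a b l : R) : geodesic_arc L s ->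
  geodesic_arc L' s' -> s 0 = s' 0 -> 0 <= a <= L -> 0 <= b <= L' -> 0 <= l <= 1 ->
  mdist (s (l * a)) (s' (l * b)) <= l * mdist (s a) (s' b).
Proof.
move=> gs gs' s0 a0 b0 l01.
have := @arc_convex _ _ catX L L' s s' 0 a 0 b l gs gs'.
by rewrite s0 mdistxx !mulr0 !add0r; apply; lra.
Qed.

(** A bounded convex function on a half-line does not increase. *)
Lemma asymptotic_mdist_le c c' (a b : R) : asymptotic c c' -> 0 <= a -> 0 <= b ->
  forall t : R, 0 <= t -> mdist (c (a + t)) (c' (b + t)) <= mdist (c a) (c' b).
Proof.
move=> /asymptotic_bound[K K0 cK] a0 b0 t t0.
pose M := K + `|a - b|.
have MP (r : R) : 0 <= r -> mdist (c (a + r)) (c' (b + r)) <= M.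
  move=> r0; have := triangle (c (a + r)) (c (b + r)) (c' (b + r)).
  rewrite mdist_ray ?(addr_ge0 a0 r0) ?(addr_ge0 b0 r0)//.
  rewrite (_ : a + r - (b + r) = a - b); last by ring.
  by have := cK _ (addr_ge0 b0 r0); rewrite /M; lra.
have M0 : 0 <= M by apply: le_trans (MP 0 _); [exact: mdist_pos|].
apply/ler_addgt0Pl => e e0.
(* [T] is so large that the far end, where the distance is at most [M], enters with weight [l] and
   contributes at most [e]. *)
pose T := t + 1 + t * M / e.
have tM : 0 <= t * M by exact: mulr_ge0.
have T1 : 0 <= t * M / e by rewrite divr_ge0// ltW.
have T0 : 0 < T by rewrite /T; lra.
pose l := t / T.
have lT : l * T = t by rewrite mulfVK; lra.
have l01 : 0 <= l <= 1 by rewrite divr_ge0 ?ler_pdivrMr /=; rewrite ?/T; lra.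
have lM : l * M <= e.
  rewrite -(ler_pM2r T0) mulrAC lT [e * _]mulrC /T !mulrDl mulfVK; last lra.
  by rewrite -[leLHS]add0r lerD2r; apply: addr_ge0; rewrite ?mulr_ge0//; lra.
have := @arc_convex _ _ catX (a + T) (b + T) c c' a (a + T) b (b + T) l
  (@arc_ray _ _ _ c) (@arc_ray _ _ _ c') ltac:(lra) ltac:(lra) ltac:(lra) ltac:(lra) l01.
have -> : (1 - l) * a + l * (a + T) = a + t by rewrite -lT; ring.
have -> : (1 - l) * b + l * (b + T) = b + t by rewrite -lT; ring.
have f0 := mdist_pos (c a) (c' b).
have := MP T (ltW T0).
move=> h1 h2; apply: le_trans h2 _; nra.
Qed.

(** Contraction brings one point of [c'] within [2 * D] of [c]; from there on the distance cannot
    grow. *)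
Lemma asymptotic_fellow_travel c c' (D u : R) : 0 < D -> ray_contracting D c ->
  asymptotic c' c -> ray_projection c (c' 0) u ->
  exists2 t0 : R, 0 <= t0 & forall t : R, 0 <= t ->
    mdist (c' (t0 + t)) (c (u + 13 * D + t)) <= 2 * D.
Proof.
move=> D0 cD cc' cu; have u0 := cu.1.
have [K K0 cK] := asymptotic_bound cc'.
(* At time [T] the projection of [c'] has passed [u + 26 * D], leaving [13 * D] on both sides of the
   target. *)
pose T := u + 26 * D + 2 * K.
have T0 : 0 <= T by rewrite /T; lra.
have [v Tv] := ray_projection_exists c (c' T).
have vT : T - 2 * K <= v.
  have := cK T T0; have := Tv.2 T T0; have := triangle (c T) (c' T) (c v).
  rewrite mdist_ray ?Tv.1// [mdist (c T) (c' T)]mdistC.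
  have : T - v <= `|T - v| by exact: ler_norm.
  by move=> *; lra.
have [|p pT pw] := @arc_near_ray _ _ catX c D T c' u v (u + 13 * D) D0 cD
  (@arc_ray _ _ _ c') T0 cu Tv (lexx _).
  by move: vT; rewrite /T; lra.
exists p; first by case/andP: pT.
move=> t t0; apply: le_trans pw.
by apply: asymptotic_mdist_le => //; lra.
Qed.

(** The ray is the pointwise limit of the arcs [s n] from [x] to [c n]. *)
Lemma asymptotic_ray_exists x c : exists sg : geodesic_ray X, sg 0 = x /\ asymptotic sg c.
Proof.
pose K := mdist x (c 0); have K0 : 0 <= K by exact: mdist_pos.
pose L (n : nat) := mdist x (c n%:R).
have L0 n : 0 <= L n by exact: mdist_pos.
have /choice[s sP] n : exists s, [/\ geodesic_arc (L n) s, s 0 = x & s (L n) = c n%:R].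
  exact: arc_exists.
have LK n : n%:R - K <= L n <= n%:R + K.
  have := triangle (c 0) x (c n%:R); have := triangle x (c 0) (c n%:R).
  rewrite [mdist (c 0) x]mdistC mdist_ray// sub0r normrN ger0_norm// -/K -/(L n).
  by lra.
have sc n (t : R) : 0 <= t <= n%:R -> 0 < n%:R :> R ->
    mdist (s n (t / n%:R * L n)) (c t) <= K.
  move=> tn n0.
  have l01 : 0 <= t / n%:R <= 1 by rewrite divr_ge0 ?ler_pdivrMr /=; lra.
  have [gs s0 sL] := sP n.
  have := @arc_convex _ _ catX (L n) n%:R (s n) c 0 (L n) 0 n%:R (t / n%:R) gs
    (@arc_ray _ _ _ c).
  rewrite !mulr0 !add0r mulfVK; last lra.
  rewrite s0 sL mdistxx mulr0 addr0 -/K => h; apply: le_trans (h _ _ _ _ _) _ => //.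
  - by rewrite lexx L0.
  - by rewrite L0 lexx.
  - by rewrite lexx ltW.
  - by rewrite ltW// lexx.
  - by rewrite ler_piMl//; lra.
(* The arc [s m] passes within [K] of [c n], at a parameter within [K] of [L n]. Scaling towards [x]
   by [l], at most [t / (n - K)], shrinks both errors. *)
have cauchy n m (t : R) : 0 <= t -> K + t < n%:R -> (n <= m)%N ->
    mdist (s n t) (s m t) <= 2 * K * t / (n%:R - K).
  move=> t0 tn nm; have nmR : n%:R <= m%:R :> R by rewrite ler_nat.
  have [gn n0 nL] := sP n; have [gm m0 mL] := sP m.
  have LKn := LK n; have LKm := LK m; have Ln := L0 n; have Lm := L0 m.
  have m_gt0 : 0 < m%:R :> R by lra.
  have Ln_gt0 : 0 < L n by lra.
  have h1 : mdist (s m (n%:R / m%:R * L m)) (c n%:R) <= K by apply: sc => //; lra.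
  set q := n%:R / m%:R * L m in h1 *.
  have qL : 0 <= q <= L m.
    by rewrite mulr_ge0 ?divr_ge0 ?ler_piMl ?ler_pdivrMr//; lra.
  pose l := t / L n.
  have lL : l * L n = t by rewrite mulfVK; lra.
  have l01 : 0 <= l <= 1 by rewrite divr_ge0 ?ler_pdivrMr /=; lra.
  have h2 : mdist (s n (l * L n)) (s m (l * q)) <= l * K.
    apply: le_trans (arc_thales gn gm _ _ qL l01) _; first by rewrite n0 m0.
      by rewrite L0 lexx.
    by rewrite nL ler_wpM2l// ?(mdistC (c _))//; lra.
  have h3 : `|q - L n| <= K.
    have := triangle x (s m q) (c n%:R); have := triangle x (c n%:R) (s m q).
    have -> : mdist x (s m q) = q.
      by rewrite -[in LHS]m0 gm ?sub0r ?normrN ?ger0_norm//; lra.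
    by rewrite [mdist (c _) (s m q)]mdistC ler_norml -/(L n); lra.
  have h4 : mdist (s m (l * q)) (s m t) <= l * K.
    rewrite gm; [|by apply/andP; split; nra|lra].
    by rewrite -lL -mulrBr normrM ger0_norm ?ler_wpM2l//; lra.
  have h5 : l <= t / (n%:R - K) by rewrite ler_wpM2l ?lef_pV2// ?posrE; lra.
  have h6 := triangle (s n t) (s m (l * q)) (s m t); rewrite lL in h2.
  rewrite (_ : 2 * K * t / _ = 2 * (t / (n%:R - K) * K)); last by ring.
  have : l * K <= t / (n%:R - K) * K by rewrite ler_wpM2r.
  lra.
have small (A B e : R) : 0 < e -> exists n : nat, [/\ K + B < n%:R & A / (n%:R - K) <= e].
  move=> e0; pose N := K + `|B| + `|A| / e.
  have Ae : 0 <= `|A| / e by rewrite divr_ge0// ltW.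
  have N0 : 0 <= N by rewrite /N !addr_ge0.
  exists (Num.trunc N).+1; have /andP[_] := truncn_itv N0.
  set n := (Num.trunc N).+1 => Nn; have BB := ler_norm B; have AA := ler_norm A.
  have B0 := normr_ge0 B.
  split; first by apply: le_lt_trans Nn; rewrite /N; lra.
  have nK : `|A| / e < n%:R - K by move: Nn; rewrite /N; lra.
  rewrite ler_pdivrMr; last lra.
  by rewrite ltr_pdivrMr// in nK; lra.
have /choice[f fP] (t : R) : exists p, 0 <= t -> forall n, K + t < n%:R ->
    mdist (s n t) p <= 2 * K * t / (n%:R - K).
  have [t0|t0] := leP 0 t; last by exists x; lra.
  have [N [NK _]] := small 0 t 1 ltr01.
  have [|p pP] := @proper_cluster (fun n => s n t) x t N.
    move=> n Nn; have [gs <- _] := sP n.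
    have NnR : N%:R <= n%:R :> R by rewrite ler_nat.
    have Lt := LK n.
    by rewrite gs ?sub0r ?normrN ?ger0_norm//; lra.
  exists p => _ n nt; apply: (pP n) => m nm; exact: cauchy.
have fray (p q : R) : 0 <= p -> 0 <= q -> mdist (f p) (f q) = `|p - q|.
  move=> p0 q0; apply/eqP; rewrite -subr_eq0 -normr_le0.
  apply/ler_addgt0Pl => e e0; rewrite addr0.
  have e20 : 0 < e / 2 by lra.
  have [n [nK ne]] := small (2 * K * (p + q)) (p + q) (e / 2) e20.
  have [gs s0 sL] := sP n; have LKn := LK n.
  have hp := fP p p0 n ltac:(lra); have hq := fP q q0 n ltac:(lra).
  have h : 2 * K * p / (n%:R - K) + 2 * K * q / (n%:R - K) <= e / 2.
    by rewrite -mulrDl -mulrDr.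
  have hpq : mdist (s n p) (s n q) = `|p - q| :> R by rewrite gs//; lra.
  have := triangle (f p) (s n p) (f q); have := triangle (s n p) (s n q) (f q).
  have := triangle (s n p) (f p) (s n q); have := triangle (f p) (f q) (s n q).
  rewrite [mdist (f p) (s n p)]mdistC [mdist (f q) (s n q)]mdistC hpq.
  by move=> t1 t2 t3 t4; rewrite ler_norml; lra.
exists (GeodesicRay fray); split=> /=.
  have [n [nK _]] := small 0 0 1 ltr01.
  have [gs s0 sL] := sP n.
  apply: mdist_positivity; apply/eqP; rewrite eq_le mdist_ge0 andbT mdistC -{1}s0.
  by apply: le_trans (fP 0 _ n _) _; rewrite ?mulr0 ?mul0r.
(* Passing from [f] to [s n] costs [2 * K], reparametrizing [s n] costs [K], and passing to [c]
   costs [K]. *)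
apply/asboolP; exists (4 * K) => t t0 /=.
have [n [nK ne]] := small (2 * K * t) t (2 * K + 1) ltac:(lra).
have [gs s0 sL] := sP n; have LKn := LK n.
have n0 : 0 < n%:R :> R by lra.
have h1 := fP t t0 n nK.
have h2 : mdist (s n (t / n%:R * L n)) (c t) <= K by apply: sc; lra.
have l01 : 0 <= t / n%:R <= 1 by rewrite divr_ge0 ?ler_pdivrMr /=; lra.
have h3 : mdist (s n t) (s n (t / n%:R * L n)) <= K.
  rewrite gs; [|lra|by rewrite mulr_ge0 ?ler_piMl//; lra].
  have -> : t - t / n%:R * L n = t / n%:R * (n%:R - L n) by field; lra.
  rewrite normrM (ger0_norm (_ : 0 <= t / n%:R)); last lra.
  have : `|n%:R - L n| <= K by rewrite ler_norml; lra.
  by have := normr_ge0 (n%:R - L n); nra.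
have h4 : 2 * K * t / (n%:R - K) <= 2 * K.
  by rewrite ler_pdivrMr ?ler_wpM2l//; lra.
have := triangle (f t) (s n t) (c t); have := triangle (s n t) (s n (t / n%:R * L n)) (c t).
by rewrite [mdist (f t) (s n t)]mdistC; lra.
Qed.

End Rays.

(** * Groups fixing a contracting point *)

Section Virtually_cyclic.
Context {R : realType} {G : groupType}.
Implicit Types (f g h k : G).

Lemma cyclic_subgroup1 g : cyclic_subgroup g 1%g.
Proof. by exists 0%N; left. Qed.

Lemma cyclic_subgroup_mulg g k :
  cyclic_subgroup g k -> cyclic_subgroup g (g * k)%g.
Proof.
move=> [n [->|->]]; first by exists n.+1; left; rewrite expgS.
case: n => [|n]; first by exists 1%N; left; rewrite expg0 invg1 mulg1.
by exists n; right; rewrite expgSr invgM mulgA mulgV mul1g.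
Qed.

Lemma cyclic_subgroup_mulVg g k :
  cyclic_subgroup g k -> cyclic_subgroup g (g^-1 * k)%g.
Proof.
move=> [[|n] [->|->]].
- by exists 1%N; right; rewrite mulg1.
- by exists 1%N; right; rewrite expg0 invg1 mulg1.
- by exists n; left; rewrite expgS mulKg.
- by exists n.+2; right; rewrite [in RHS]expgSr invgM.
Qed.

Lemma cyclic_subgroupM g h k :
  cyclic_subgroup g h -> cyclic_subgroup g k -> cyclic_subgroup g (h * k)%g.
Proof.
move=> [n [->|->]] gk; elim: n => [|n IH].
- by rewrite mul1g.
- by rewrite expgS -mulgA; exact: cyclic_subgroup_mulg.
- by rewrite expg0 invg1 mul1g.
- by rewrite expgSr invgM -mulgA; exact: cyclic_subgroup_mulVg.
Qed.

Lemma cyclic_subgroupV g h : cyclic_subgroup g h -> cyclic_subgroup g h^-1%g.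
Proof. by move=> [n [->|->]]; exists n; [right|left; rewrite invgK]. Qed.

Lemma left_coset_mulr g f h : cyclic_subgroup g h ->
  left_coset (cyclic_subgroup g) (f * h)%g = left_coset (cyclic_subgroup g) f.
Proof.
move=> gh; apply/seteqP; split=> _ [k gk <-].
  by exists (h * k)%g; [exact: cyclic_subgroupM|rewrite mulgA].
exists (h^-1 * k)%g; last by rewrite -mulgA mulVKg.
by apply: cyclic_subgroupM => //; exact: cyclic_subgroupV.
Qed.

(** If [s] is bounded above it is bounded, and [G] is finite. Otherwise multiplying by powers of one
    [g] with large [s g] brings every element into a single finite fibre. *)
Lemma quasimorphism_virtually_cyclic (s : G -> R) (Q : R) : 0 < Q ->
  (forall f g, `|s (f * g)%g - s f - s g| <= Q) ->
  (forall r : R, finite_set [set f | `|s f| <= r]) -> virtually_cyclic G.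
Proof.
move=> Q0 sQ sfin.
have qm f g : - Q <= s (f * g)%g - s f - s g <= Q by have := sQ f g; rewrite ler_norml.
have [[g gQ]|ng] := pselect (exists g, 3 * Q < s g); last first.
  exists 1%g; apply: finite_image; apply: sub_finite_set (sfin (5 * Q)) => f _ /=.
  have up h : s h <= 3 * Q by rewrite leNgt; apply/negP => lt; apply: ng; exists h.
  have := up f; have := up f^-1%g; have := qm f f^-1%g; have := qm 1%g 1%g.
  by rewrite mulgV mulg1 ler_norml; lra.
(* Outside the band of half-width [W] a factor [g] or its inverse lowers the absolute value of [s]
   by more than [Q] without changing the sign. *)
exists g; pose W := s g + Q.
apply: (@sub_finite_set _ _ (left_coset (cyclic_subgroup g) @` [set f | `|s f| <= W])).
  move=> _ [f _ <-].
  suff [h gh hW] : exists2 h, cyclic_subgroup g h & `|s (f * h)%g| <= W.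
    by exists (f * h)%g => //; exact: left_coset_mulr.
  have /andP[_] := truncn_itv (divr_ge0 (normr_ge0 (s f)) (ltW Q0)).
  move: (Num.trunc _).+1 => n; rewrite ltr_pdivrMr// => /ltW.
  elim: n f => [|n IH] f fn.
    exists 1%g; first exact: cyclic_subgroup1.
    by rewrite mulg1 /W; apply: le_trans fn _; rewrite mul0r; lra.
  have [fW|fW] := leP `|s f| W.
    by exists 1%g; [exact: cyclic_subgroup1|rewrite mulg1].
  have fn' : `|s f| - Q <= n%:R * Q by move: fn; rewrite -natr1 mulrDl mul1r; lra.
  have [f0|f0] := leP 0 (s f).
    rewrite ger0_norm// in fW fn'.
    have := qm (f * g^-1)%g g; rewrite mulgVK => fg.
    have [|h gh hW] := IH (f * g^-1)%g.
      by rewrite ler_norml; move: fW fn'; rewrite /W; lra.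
    by exists (g^-1 * h)%g; [exact: cyclic_subgroup_mulVg|rewrite mulgA].
  rewrite ltr0_norm// in fW fn'.
  have fg := qm f g.
  have [|h gh hW] := IH (f * g)%g.
    by rewrite ler_norml; move: fW fn'; rewrite /W; lra.
  by exists (g * h)%g; [exact: cyclic_subgroup_mulg|rewrite mulgA].
exact/finite_image/sfin.
Qed.

End Virtually_cyclic.

(** * Isometric actions and the shift along a fixed contracting ray *)

Section Actions.
Context {R : realType} {X : metricType R} {G : groupType}.
Variable a : isometric_action G X.
Implicit Types (c : geodesic_ray X) (x y z : X) (g h f : G).

Lemma mdist_act g y z : mdist (a g y) (a g z) = mdist y z :> R.
Proof. exact: act_mdist. Qed.

Lemma mdist_actV g y z : mdist (a g^-1%g y) z = mdist y (a g z) :> R.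
Proof. by rewrite -(mdist_act g) -actM mulgV act1. Qed.

Lemma act_ray_contracting (D : R) c g :
  ray_contracting D c -> ray_contracting D (act_ray a g c).
Proof.
move=> cD y z u v [u0 yu] [v0 zv] yz.
apply: (cD (a g^-1%g y) (a g^-1%g z)).
- by split=> // p p0; rewrite !mdist_actV; exact: yu.
- by split=> // p p0; rewrite !mdist_actV; exact: zv.
- by rewrite mdist_act mdist_actV.
Qed.

Lemma cocompact_orbit_dense x : cocompact a ->
  exists C : R, forall y, exists g, mdist (a g x) y <= C.
Proof.
move=> [K cK aK].
have [r Kr] := compact_bounded_mdist x cK.
have [g0 _ [k0 Kk0 k0x]] : (\bigcup_g (a g @` K)) x by rewrite aK.
exists (2 * r) => y.
have [g _ [k Kk ky]] : (\bigcup_g (a g @` K)) y by rewrite aK.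
exists (g * g0^-1)%g; rewrite -ky actM mdist_act.
have -> : a g0^-1%g x = k0 by rewrite -k0x -actM mulVg act1.
have k0r : mdist x k0 <= r := Kr k0 Kk0; have kr : mdist x k <= r := Kr k Kk.
by have := triangle k0 x k; rewrite [mdist k0 x]mdistC; lra.
Qed.

Lemma finite_return x (r : R) : proper_space X -> properly_discontinuous a ->
  finite_set [set g | mdist (a g x) x <= r].
Proof.
move=> propX pd; apply: sub_finite_set (pd _ (propX x r)) => g /= gr.
exists (a g x); split=> /=; last by rewrite metric_sym.
by exists x => //=; rewrite mdistxx; apply: le_trans gr; exact: mdist_ge0.
Qed.

Hypotheses (propX : proper_space X) (catX : CAT0 X).

Lemma act_ray_shift (D : R) c g : 0 < D -> ray_contracting D c ->
  asymptotic (act_ray a g c) c -> exists r T : R,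
    [/\ 0 <= T, 0 <= T + r & forall t, T <= t -> mdist (a g (c t)) (c (t + r)) <= 2 * D].
Proof.
move=> D0 cD gc.
have [u cu] := ray_projection_exists c (act_ray a g c 0); have u0 := cu.1.
have [t0 t00 ft] := asymptotic_fellow_travel catX D0 cD gc cu.
exists (u + 13 * D - t0), t0; split=> //; first lra.
move=> t tt; have := ft (t - t0) ltac:(lra).
by rewrite /= (_ : t0 + (t - t0) = t) 1?(_ : u + 13 * D + (t - t0) = t + (u + 13 * D - t0)) //; ring.
Qed.

Lemma seq_upper_bound (T : eqType) (F : T -> R) (l : seq T) :
  exists2 t : R, 0 <= t & forall i, i \in l -> F i <= t.
Proof.
elim: l => [|i l [t t0 tl]]; first by exists 0.
exists (t + `|F i|); first by rewrite addr_ge0.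
move=> j; rewrite inE => /orP[/eqP ->|/tl jt].
  by apply: le_trans (ler_norm _) _; rewrite lerDr.
by apply: le_trans jt _; rewrite lerDl.
Qed.

(* [G] translates along [c] by a quasimorphism.  Its bounded fibres are finite:
   conjugating by an element that moves a point of [c] far along it to a
   neighbourhood of the base point injects any finite part of a fibre into one
   fixed finite set. *)
Lemma fixed_contracting_virtually_cyclic (D : R) c : geometric_action a -> 0 < D ->
  ray_contracting D c -> (forall g, asymptotic (act_ray a g c) c) -> virtually_cyclic G.
Proof.
move=> [pd cc] D0 cD fixc.
have /choice[s /choice[T sP]] g := act_ray_shift D0 cD (fixc g).
have T0 g : 0 <= T g by case: (sP g).
have Ts0 g : 0 <= T g + s g by case: (sP g).
have sh g t : T g <= t -> mdist (a g (c t)) (c (t + s g)) <= 2 * D.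
  by case: (sP g) => _ _; apply.
apply: (@quasimorphism_virtually_cyclic _ _ s (6 * D)); first lra.
  (* At so late a time all three shifts are valid; each contributes an error [2 * D]. *)
  move=> f g; pose t := T (f * g)%g + T g + T f + `|s g|.
  have g0 := normr_ge0 (s g); have gn : - `|s g| <= s g by rewrite lerNnormlW.
  have h1 := sh (f * g)%g t; have h2 := sh g t; have h3 := sh f (t + s g).
  have T1 := T0 (f * g)%g; have T2 := T0 g; have T3 := T0 f.
  have S1 := Ts0 (f * g)%g; have S2 := Ts0 g; have S3 := Ts0 f.
  have tE : t = T (f * g)%g + T g + T f + `|s g| by [].
  clearbody t.
  move: h1 h2 h3 => /(_ ltac:(lra)) h1 /(_ ltac:(lra)) h2 /(_ ltac:(lra)) h3.
  rewrite actM in h1; rewrite -(mdist_act f) in h2.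
  have := triangle (c (t + s (f * g)%g)) (a f (a g (c t))) (c (t + s g + s f)).
  have := triangle (a f (a g (c t))) (a f (c (t + s g))) (c (t + s g + s f)).
  rewrite mdist_ray; [|lra|lra].
  rewrite [mdist (c _) (a f (a g (c t)))]mdistC.
  by rewrite (_ : t + s (f * g)%g - (t + s g + s f) = s (f * g)%g - s f - s g); [lra|ring].
move=> r; apply: contrapT => /infinite_set_fset infA.
have [C CP] := cocompact_orbit_dense (c 0) cc.
(* An element of the fibre moves [c t] by at most [2 * D + r], and [h] brings [c 0] within [C] of
   [c t], which enters twice in a conjugate. *)
have /finite_fsetP[F FE] := finite_return (c 0) (2 * D + r + 2 * C) propX pd.
have [B BA BF] := infA (size (finmap.enum_fset F)).+1.
have [t t0 tB] := seq_upper_bound T (finmap.enum_fset B).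
have [h hC] := CP (c t).
pose conj f := (h^-1 * f * h)%g.
suff : (size (map conj (finmap.enum_fset B)) <= size (finmap.enum_fset F))%N.
  by rewrite size_map leqNgt BF.
apply: uniq_leq_size.
  rewrite map_inj_uniq ?finmap.fset_uniq// => f g /(congr1 (fun k => h * k * h^-1)%g).
  by rewrite /conj !mulgA mulgV !mul1g !mulgK.
move=> _ /mapP[f fB ->].
have /seteqP[FF _] := FE.
apply: FF => /=.
have fr : `|s f| <= r := BA f fB.
have Tf := tB f fB; have Tsf := Ts0 f; have sf := sh f t Tf.
rewrite /conj !actM mdist_actV.
have := triangle (a f (a h (c 0))) (a f (c t)) (a h (c 0)).
have := triangle (a f (c t)) (c (t + s f)) (a h (c 0)).
have := triangle (c (t + s f)) (c t) (a h (c 0)).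
rewrite mdist_ray; [|lra|lra].
rewrite mdist_act [mdist (c t) (a h _)]mdistC (_ : t + s f - t = s f); last by ring.
lra.
Qed.

End Actions.

(** * Translates of a contracting point *)

Section Approach.
Context {R : realType} {X : metricType R}.
Hypotheses (propX : proper_space X) (catX : CAT0 X).
Implicit Types (c b sg : geodesic_ray X) (x y z : X).

(* Both rays follow the geodesic from their origin to [x] for a long time, and
   these two geodesics end at the same point. *)
Lemma backtracking_rays_close c1 c2 (D u1 u2 w : R) x : 0 < D ->
  ray_contracting D c1 -> ray_contracting D c2 ->
  ray_projection c1 x u1 -> ray_projection c2 x u2 ->
  13 * D <= w -> w <= u1 - 13 * D -> w <= u2 - 13 * D ->
  mdist (c1 w) (c2 w) <= 8 * D + 2 * mdist (c1 0) (c2 0).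
Proof.
move=> D0 cD1 cD2 xu1 xu2 wD w1 w2.
have near c u : ray_contracting D c -> ray_projection c x u -> w <= u - 13 * D ->
    exists s (p : R), [/\ geodesic_arc (mdist (c 0) x) s, s 0 = c 0 /\ s (mdist (c 0) x) = x,
      0 <= p <= mdist (c 0) x, mdist (s p) (c w) <= 2 * D & `|p - w| <= 2 * D].
  move=> cD xu wu.
  have [s [gs s0 sx]] := arc_exists catX (c 0) x.
  have c00 : ray_projection c (s 0) 0.
    by split=> // p _; rewrite s0 mdistxx; exact: mdist_pos.
  have xu' : ray_projection c (s (mdist (c 0) x)) u by rewrite sx.
  have [p pL pw] := arc_near_ray catX D0 cD gs (mdist_pos _ _) c00 xu'
    (ltac:(lra) : 0 + 13 * D <= w) wu.
  exists s, p; split=> //.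
  have := triangle (c 0) (s p) (c w); have := triangle (c 0) (c w) (s p).
  rewrite [mdist (c w) (s p)]mdistC mdist_ray; [|lra|lra].
  have -> : mdist (c 0) (s p) = p.
    by rewrite -s0 gs ?sub0r ?normrN ?ger0_norm; lra.
  by rewrite sub0r normrN ger0_norm ?ler_norml; lra.
have [s1 [p1 [gs1 [s10 s1x] p1L p1w p1e]]] := near c1 u1 cD1 xu1 w1.
have [s2 [p2 [gs2 [s20 s2x] p2L p2w p2e]]] := near c2 u2 cD2 xu2 w2.
set L1 := mdist (c1 0) x in gs1 s1x p1L; set L2 := mdist (c2 0) x in gs2 s2x p2L.
set d0 := mdist (c1 0) (c2 0).
have L20 : 0 <= L2 by exact: mdist_pos.
have L10 : 0 <= L1 by exact: mdist_pos.
have d00 : 0 <= d0 by exact: mdist_pos.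
have L12 : - d0 <= L2 - L1 <= d0.
  have := triangle (c1 0) (c2 0) x; have := triangle (c2 0) (c1 0) x.
  by rewrite [mdist (c2 0) (c1 0)]mdistC -/d0 -/L1 -/L2; lra.
have [l [l01 lL]] : exists l : R, 0 <= l <= 1 /\ l * L1 = p1.
  have [E|n0] := eqVneq L1 0; first by exists 0; split; lra.
  have L1p : 0 < L1 by lra.
  exists (p1 / L1); split; last by rewrite mulfVK.
  by rewrite divr_ge0 ?ler_pdivrMr /=; lra.
have := @arc_convex _ _ catX L1 L2 s1 s2 0 L1 0 L2 l gs1 gs2 ltac:(lra) ltac:(lra)
  ltac:(lra) ltac:(lra) l01.
rewrite !mulr0 !add0r s1x s2x mdistxx mulr0 addr0 s10 s20 lL -/d0 => h1.
have lL2 : 0 <= l * L2 <= L2 by apply/andP; split; nra.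
have h2 : mdist (s2 (l * L2)) (s2 p2) <= d0 + 4 * D.
  rewrite gs2// ler_norml; move: p1e p2e; rewrite !ler_norml => p1e p2e.
  have : - d0 <= l * L2 - p1 <= d0 by rewrite -lL -mulrBr; apply/andP; split; nra.
  by lra.
have h3 : (1 - l) * d0 <= d0 by nra.
(* The total is [2 * D] at each ray, [d0] between the arcs, and [d0 + 4 * D] along [s2]. *)
have := triangle (c1 w) (s1 p1) (c2 w).
have := triangle (s1 p1) (s2 (l * L2)) (c2 w).
have := triangle (s2 (l * L2)) (s2 p2) (c2 w).
by rewrite [mdist (c1 w) (s1 p1)]mdistC; lra.
Qed.

Lemma not_asymptotic_far c c' (w M : R) : 0 <= w -> ~ asymptotic c c' ->
  exists2 t : R, w <= t & M < mdist (c t) (c' t).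
Proof.
move=> w0 ncc; apply: contrapT => nf; apply: ncc; apply/asboolP.
have M0 : 0 <= `|M| by [].
exists (`|M| + mdist (c 0) (c' 0) + 2 * w) => t t0.
have d0 := mdist_pos (c 0) (c' 0).
have [wt|wt] := leP w t.
  have : mdist (c t) (c' t) <= M.
    by rewrite leNgt; apply/negP => lt; apply: nf; exists t.
  by move=> h; apply: (le_trans h); apply: le_trans (ler_norm M) _; rewrite -addrA lerDl; lra.
have := triangle (c t) (c 0) (c' t); have := triangle (c 0) (c' 0) (c' t).
rewrite [mdist (c t) (c 0)]mdist_ray// [mdist (c' 0) (c' t)]mdist_ray//.
rewrite sub0r normrN subr0 ger0_norm// => h1 h2.
have h : mdist (c t) (c' t) <= `|M| + mdist (c 0) (c' 0) + 2 * w :> R by lra.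
exact: h.
Qed.

(* [sg] follows [b] up to time about [n] and [c] afterwards, so every point of
   [sg] not too close to [sg n] is a bottleneck. *)
Lemma concatenation_contracting (D E : R) : 0 < D -> 0 <= E ->
  exists2 D' : R, D <= D' & forall b c (u n : R), 0 < n ->
    ray_contracting D b -> ray_contracting D c -> ray_projection c (b 0) u ->
    mdist (c (u + 13 * D)) (b n) <= E -> exists sg,
    [/\ sg 0 = b 0, asymptotic sg c, ray_contracting D' sg &
      forall t : R, 0 <= t <= n -> mdist (sg t) (b t) <= t / n * (2 * (2 * D + E))].
Proof.
move=> D0 E0; pose E1 := 2 * D + E.
have E10 : 0 <= E1 by rewrite /E1; lra.
pose K := 2 * (2 * E1) + 39 * D.
have K0 : 0 <= K by rewrite /K; lra.
exists (2 * K + (E1 + 3 * K) + 4 * (2 * D + 2 * E1)); first by rewrite /K; lra.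
move=> b c u n n0 bD cD bu cb.
have [sg [sg0 sgc]] := asymptotic_ray_exists propX catX (b 0) c.
have u0 := bu.1.
rewrite -sg0 in bu.
have [t0 t00 ft] := asymptotic_fellow_travel catX D0 cD sgc bu.
have st0 : mdist (sg t0) (b n) <= E1.
  have := ft 0 (lexx _); rewrite !addr0 => h.
  by have := triangle (sg t0) (c (u + 13 * D)) (b n); rewrite /E1; lra.
have t0n : - E1 <= t0 - n <= E1.
  have := triangle (b 0) (sg t0) (b n); have := triangle (b 0) (b n) (sg t0).
  rewrite [mdist (b n) _]mdistC -{1 4}sg0 !mdist_ray//; try lra.
  by rewrite !sub0r !normrN !ger0_norm//; lra.
have sn : mdist (sg n) (b n) <= 2 * E1.
  have := triangle (sg n) (sg t0) (b n); rewrite mdist_ray//; last lra.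
  have : `|n - t0| <= E1 by rewrite ler_norml; lra.
  by lra.
have close t : 0 <= t <= n -> mdist (sg t) (b t) <= t / n * (2 * E1).
  move=> tn.
  have l01 : 0 <= t / n <= 1 by rewrite divr_ge0 ?ler_pdivrMr /=; lra.
  have := @arc_thales _ _ catX n n sg b n n (t / n) (@arc_ray _ _ _ sg) (@arc_ray _ _ _ b)
    sg0 ltac:(lra) ltac:(lra) l01.
  rewrite mulfVK; last lra.
  by move=> h; apply: le_trans h _; rewrite ler_wpM2l//; lra.
exists sg; split=> //.
apply: (bottlenecks_contracting catX); try (rewrite ?/E1; lra) => //.
move=> t1 t10.
(* Either the window about [t1 + K] ends before [n], where [sg] follows [b], or the window about
   [t1 + E1 + 3 * K] starts after [t0], where [sg] follows [c]. *)
have [le|lt] := leP (t1 + K + K) n.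
  exists (t1 + K); first lra.
  split; first lra.
  apply: (@bottleneck_transfer _ _ catX sg b D (2 * E1) 0) => //; rewrite -?/K; try lra.
  move=> p pK; rewrite addr0.
  have pn : 0 <= p <= n by lra.
  apply: le_trans (close p pn) _.
  have : p / n <= 1 by rewrite ler_pdivrMr; lra.
  by move=> h; rewrite ler_piMl//; lra.
exists (t1 + E1 + 3 * K); first lra.
split; first lra.
apply: (@bottleneck_transfer _ _ catX sg c D (2 * E1) (u + 13 * D - t0)) => //;
  rewrite -?/K; try lra.
move=> p pK.
have := ft (p - t0) ltac:(lra).
rewrite (_ : t0 + (p - t0) = p); last by ring.
rewrite (_ : u + 13 * D + (p - t0) = p + (u + 13 * D - t0)); last by ring.
by move=> h; apply: le_trans h _; rewrite /E1; lra.
Qed.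

Variables (G : groupType) (a : isometric_action G X).

(** The constant [D'] is fixed before [r] and [e], which is what keeps all approximating points in
    one stratum. *)
Lemma translate_approaches b c (D : R) k : geometric_action a -> b 0 = c 0 -> 0 < D ->
  ray_contracting D b -> ray_contracting D c -> ~ asymptotic (act_ray a k c) c ->
  exists2 D' : R, D <= D' & forall r e : R, 0 < e -> exists g sg,
    [/\ sg 0 = b 0, asymptotic sg (act_ray a g c), ray_contracting D' sg &
      forall t : R, 0 <= t <= r -> mdist (b t) (sg t) < e].
Proof.
move=> [_ cc] bc D0 bD cD nk.
have [C CP] := cocompact_orbit_dense (b 0) cc.
pose d0 := mdist (b 0) (a k (b 0)); have d00 : 0 <= d0 by exact: mdist_pos.
have C0 : 0 <= C by have [g] := CP (b 0); apply: le_trans; exact: mdist_pos.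
have [w wD wfar] := @not_asymptotic_far (act_ray a k c) c (13 * D) (8 * D + 2 * d0)
  ltac:(lra) nk.
pose U := w + 13 * D.
(* The translated ray starts within [C + d0] of [b n] and is joined at a time at most
   [U + 13 * D]. *)
pose E := U + 13 * D + (C + d0); have E0 : 0 <= E by rewrite /E /U; lra.
have [D' DD' sgP] := concatenation_contracting D0 E0.
exists D' => // r e e0.
pose H := 2 * (2 * D + E); have H0 : 0 <= H by rewrite /H; lra.
have re : 0 <= `|r| * H / e.
  by apply: divr_ge0; [apply: mulr_ge0|apply: ltW].
have N0 : 0 <= `|r| + `|r| * H / e by apply: addr_ge0.
(* This [n] exceeds [r] and makes the linear bound [t / n * H] smaller than [e] up to time [r]. *)
have /andP[_] := truncn_itv N0; move: (_.+1) => n nP.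
have rr : r <= `|r| by exact: ler_norm.
have r0 : 0 <= `|r| by [].
have n0 : 0 < n%:R :> R by lra.
have nH : `|r| * H < n%:R * e by rewrite -ltr_pdivrMr//; lra.
have [g gn] := CP (b n%:R).
have [g' [u [xu uU gx]]] : exists g' u, [/\ ray_projection (act_ray a g' c) (b 0) u,
    u <= U & mdist (a g' (c 0)) (b n%:R) <= C + d0].
  have [u1 xu1] := ray_projection_exists (act_ray a g c) (b 0).
  have [u2 xu2] := ray_projection_exists (act_ray a (g * k)%g c) (b 0).
  have [u1U|Uu1] := leP u1 U.
    by exists g, u1; split=> //; rewrite -bc; lra.
  have [u2U|Uu2] := leP u2 U.
    exists (g * k)%g, u2; split=> //.
    rewrite actM -bc; have := triangle (a g (a k (b 0))) (a g (b 0)) (b n%:R).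
    by rewrite mdist_act [mdist (a k _) _]mdistC -/d0; lra.
  (* If both projections exceeded [U], the two rays would be close at time [w], against the choice
     of [w]. *)
  have := @backtracking_rays_close (act_ray a g c) (act_ray a (g * k)%g c) D u1 u2 w (b 0)
    D0 (act_ray_contracting cD) (act_ray_contracting cD) xu1 xu2 wD
    ltac:(rewrite /U in Uu1; lra) ltac:(rewrite /U in Uu2; lra).
  rewrite /= !actM !mdist_act -bc -/d0 mdistC.
  by move: wfar => /=; lra.
have [||sg [s1 s2 s3 s4]] := sgP b (act_ray a g' c) u n%:R n0 bD _ xu _.
- exact: act_ray_contracting.
- have := triangle (act_ray a g' c (u + 13 * D)) (act_ray a g' c 0) (b n%:R).
  rewrite mdist_ray//; last by have := xu.1; lra.
  rewrite subr0 ger0_norm; last by have := xu.1; lra.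
  by rewrite /= /E; lra.
exists g', sg; split=> // t tr.
rewrite mdistC; apply: le_lt_trans (s4 t _) _; first lra.
rewrite -/H mulrAC ltr_pdivrMr// [e * _]mulrC; apply: le_lt_trans nH.
by rewrite ler_wpM2r//; lra.
Qed.

End Approach.

(** * Density of orbits in the direct limit topology *)

Theorem theorem4p1 (R : realType) (X : metricType R) (G : groupType)
    (a : isometric_action G X) (x : X) :
  proper_space X -> CAT0 X -> geometric_action a ->
  [set: contracting_boundary x] !=set0 ->
  ~ virtually_cyclic G ->
  forall alpha : contracting_boundary x, dense (contracting_orbit a alpha).
Proof.
move=> propX catX geoX _ nvc alpha O [beta Obeta] oO.
have [Da Da0 [c [c0 cE] /contracting_ray_image cDa]] := cb_contracting alpha.
have [Db Db0 [b [b0 bE] /contracting_ray_image bDb]] := cb_contracting beta.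
pose D := Da + Db + 1.
have D0 : 0 < D by rewrite /D; lra.
have cD : ray_contracting D c by apply: ray_contractingW cDa; rewrite /D; lra.
have bD : ray_contracting D b by apply: ray_contractingW bDb; rewrite /D; lra.
have [k nk] : exists k, ~ asymptotic (act_ray a k c) c.
  apply: contrapT => nk; apply: nvc.
  apply: (fixed_contracting_virtually_cyclic propX catX geoX D0 cD) => g.
  by apply: contrapT => ng; apply: nk; exists g.
have [D' DD' sgP] := translate_approaches propX catX geoX (etrans b0 (esym c0)) D0 bD cD nk.
have D'0 : 0 <= D' by lra.
(* On the stratum of [D'] the set [O] is the trace of a cone-open [V], so it suffices to approach
   [beta] in the cone topology inside that stratum. *)
have [V oV VO] := (open_subspaceP _ _).1 (oO D' D'0).
have Vbeta : V (cb_point beta).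
  have : (V `&` @contracting_stratum _ _ x D') (cb_point beta); last by case.
  rewrite VO; split; last by exists b => //; apply/contracting_ray_image/(ray_contractingW DD').
  split; first by exists beta.
  by exists b => //; apply/contracting_ray_image/(ray_contractingW DD').
have [r [e [r0 e0 VB]]] := oV _ Vbeta.
have [g [sg [sg0 sgc sgD sgb]]] := sgP r e e0.
pose eta : visual_boundary x := \pi_(boundary X)%qT sg.
have sge : represents x sg eta by split=> //; rewrite sg0.
have etaD : contracting_stratum D' eta.
  by exists sg => //; apply/contracting_ray_image.
have Veta : V eta by apply: VB; exists b, sg; split.
have : (V `&` @contracting_stratum _ _ x D') eta by split.
rewrite VO; case; case; case=> o Oo oE _ _; exists o; split=> //.
exists g; rewrite oE -cE act_boundary_pi.
exact/eqmodP.
Qed.
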